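(* (Fourier inversion) The inverse of the Wedderburn isomorphism $\omega$ is given by $$\prod_{i\in[1,k]}\operatorname{End}_{K_i}X_i\;\overset{\omega^{-1}}{\longrightarrow}\;L\wr G,\qquad(\phi_i)_{i\in[1,k]}\;\longmapsto\;\frac1n\sum_{\sigma\in G,\ l\in[1,h]}\sigma y_l\left[\sum_{i\in[1,k]}\frac{x_id_i}{h}\cdot\operatorname{tr}_{K_i/K}\operatorname{Tr}_{K_i}\Big((y_l^\ast\sigma^{-1})\omega_i\cdot\phi_i\Big)\right].$$
   Context: A finite group $G$ acts (from the right, $y\mapsto y^\sigma$, by field automorphisms, not necessarily faithfully) on a field $L$ with fixed field $K$. Let $N$ be the kernel of this operation, $g=|G|$, $h=[L:K]$, $n=|N|$. Assume that $n$ is invertible in $K$. Let $(y_l)_{l\in[1,h]}$ be a $K$-basis of $L$ and $(y_l^\ast)_{l\in[1,h]}$ its dual basis with respect to the trace, $\operatorname{Tr}_{L/K}(y_ly_m^\ast)=\delta_{l,m}$. The twisted group ring $L\wr G$ is the $K$-algebra which as a right $L$-vector space has basis $G$, with multiplication determined by $(\sigma y)(\tau z)=(\sigma\tau)(y^\tau z)$. It is semisimple. Let $X_1,\dots,X_k$ be representatives of the isomorphism classes of simple right $L\wr G$-modules, $K_i=\operatorname{End}_{L\wr G}X_i$ (a skew field, acting on $X_i$ from the left), $x_i$ the left $K_i$-dimension of $X_i$, $d_i^2=[K_i:Z(K_i)]$ with $d_i\ge1$. It is known that $x_id_i/h$ is an integer. The map $\omega_i:L\wr G\to\operatorname{End}_{K_i}X_i$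 is the operation of $L\wr G$ on $X_i$, and $\omega=(\omega_i)_i:L\wr G\to\prod_i\operatorname{End}_{K_i}X_i$ is the Wedderburn isomorphism; maps are written and composed on the right. Choosing a $K_i$-basis, $X_i$ is viewed as rows over $K_i$ and $\operatorname{End}_{K_i}X_i$ as the ring of $x_i\times x_i$-matrices over $K_i$. $\operatorname{Tr}_{K_i}$ is the sum of the diagonal entries, and $\operatorname{tr}_{K_i/K}=\operatorname{Tr}_{Z(K_i)/K}\circ\operatorname{tr}_{K_i/Z(K_i)}$, where $\operatorname{tr}_{K_i/Z(K_i)}$ is the reduced trace; the composite $\operatorname{tr}_{K_i/K}\operatorname{Tr}_{K_i}$ is independent of the basis. *)

(* Defs.v *)
From HB Require Import structures.
From mathcomp Require Import all_boot all_order all_algebra all_fingroup all_field.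

Set Implicit Arguments.
Unset Strict Implicit.
Unset Printing Implicit Defensive.

Import GRing.Theory.
Local Open Scope ring_scope.

Section Traces.

Variable K : fieldType.

Definition endo_trace (V : vectType K) (f : 'End(V)) : K :=
  \tr (passmx.mxof (vbasis {:V}) (vbasis {:V}) f).

Definition alg_trace (A : falgType K) (a : A) : K := endo_trace (amull a).

Definition alg_center (D : falgType K) : {aspace D} := 'Z({:D})%AS.

(* A field E over Z = Z(D) with an isomorphism from E (x)_Z D to the algebra  *)
(* of d x d matrices over E, given as the Z-algebra morphism D -> 'M[E]_d it  *)
(* comes from. For d ^ 2 = [D : Z], the spanning axiom says that the induced  *)
(* E-linear map from E (x)_Z D is bijective.                                  *)
Record splitting (D : falgType K) (d : nat) := Splitting {
  split_field : fieldType;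
  split_inj : {rmorphism subvs_of (alg_center D) -> split_field};
  split_rep : {rmorphism D -> 'M[split_field]_d};
  split_repZ : forall z : subvs_of (alg_center D),
    split_rep (vsval z) = (split_inj z)%:M;
  split_span : forall M : 'M[split_field]_d,
    exists s : seq (split_field * D), M = \sum_(p <- s) p.1 *: split_rep p.2
}.

(* The traces computed in any two splittings come from the same map D -> Z,   *)
(* so for central simple D over Z this determines trd.                        *)
Definition is_reduced_trace (D : falgType K) (d : nat)
    (trd : D -> subvs_of (alg_center D)) : Prop :=
  exists S : splitting D d, forall a : D,
    split_inj S (trd a) = \tr (split_rep S a).

End Traces.

Section TwistedGroupRing.

Variables (gT : finGroupType) (K : fieldType) (L : fieldExtType K).

Record field_action := FieldAction {
  faction :> {action gT &-> L};
  factionD : forall s, {morph faction^~ s : x y / x + y};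
  factionM : forall s, {morph faction^~ s : x y / x * y};
  faction1 : forall s, faction 1 s = 1;
  faction_fixed : forall y, (forall s, faction y s = y) <-> y \in 1%VS
}.

Implicit Type to : field_action.

Definition faut to (s : gT) (y : L) : L := to y s.

Lemma faut_linear to s : linear (faut to s).
Proof.
move=> c x y; rewrite /faut factionD -[c *: x]mulr_algl factionM.
by have /(_ s) -> := (faction_fixed to c%:A).2 (rpredZ c (mem1v _)); rewrite mulr_algl.
Qed.

HB.instance Definition _ to s :=
  GRing.isLinear.Build K L L *:%R (faut to s) (faut_linear to s).

Lemma faction0 to s : to 0 s = 0.
Proof. exact: (linear0 (faut to s)). Qed.

Lemma factionZ to s c y : to (c *: y) s = c *: to y s.
Proof. exact: (linearZ_LR (faut to s)). Qed.

Lemma faction_sum to s I (r : seq I) P (F : I -> L) :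
  to (\sum_(i <- r | P i) F i) s = \sum_(i <- r | P i) to (F i) s.
Proof. exact: (linear_sum (faut to s)). Qed.

Lemma faction_mulg to y s t : to y (s * t)%g = to (to y s) t.
Proof. by case: (faction to) => a [inj_a aM] /=; apply: aM; rewrite inE. Qed.

Lemma faction_id to y : to y 1%g = y.
Proof.
by case: (faction to) => a [inj_a aM] /=; apply: (inj_a 1%g); rewrite -aM ?inE ?mulg1.
Qed.

Definition action_kernel to : {set gT} := [set s | linfun (faut to s) == \1%VF].

Lemma action_kernelP to s :
  reflect (forall y, to y s = y) (s \in action_kernel to).
Proof.
rewrite inE; apply: (iffP eqP) => [e y | e].
  by have := lfunE (faut to s) y; rewrite e id_lfunE => /esym.
by apply/lfunP=> y; rewrite lfunE id_lfunE; apply: e.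
Qed.

(* u : twisted_ring to stands for the sum of the s (u s), s ranging over gT   *)
(* (tw_sum), and tw to s y for s y; tw_mulE is the multiplication rule.       *)
Definition twisted_ring (to : field_action) : Type := {ffun gT -> L}.

HB.instance Definition _ to := Vector.copy (twisted_ring to) {ffun gT -> L}.

Definition tw to (s : gT) (y : L) : twisted_ring to :=
  [ffun t => if t == s then y else 0].

Definition tw_mul to (u v : twisted_ring to) : twisted_ring to :=
  [ffun r => \sum_t to (u (r * t^-1)%g) t * v t].

Fact tw_mulA to : associative (@tw_mul to).
Proof.
move=> u v w; apply/ffunP=> r; rewrite !ffunE.
under eq_bigr => t _ do rewrite ffunE mulr_sumr.
under [RHS]eq_bigr => t _ do
  rewrite ffunE faction_sum mulr_suml.
rewrite [RHS]exchange_big [LHS]exchange_big /=.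
rewrite [RHS]exchange_big /=; apply: eq_bigr => t _.
rewrite (reindex_inj (mulIg t)) /=; apply: eq_bigr => q _.
rewrite mulgK factionM mulrA; congr (_ * _ * _).
by rewrite -faction_mulg invMg !mulgA.
Qed.

Fact tw_mul1l to : left_id (tw to 1%g 1) (@tw_mul to).
Proof.
move=> u; apply/ffunP=> r; rewrite ffunE (bigD1 r) //= ffunE mulgV eqxx.
rewrite faction1 mul1r big1 ?addr0 // => t ntr.
by rewrite ffunE -eq_mulgV1 eq_sym (negPf ntr) faction0 mul0r.
Qed.

Fact tw_mul1r to : right_id (tw to 1%g 1) (@tw_mul to).
Proof.
move=> u; apply/ffunP=> r; rewrite ffunE (bigD1 1%g) //= ffunE eqxx.
rewrite invg1 mulg1 mulr1 faction_id big1 ?addr0 // => t nt1.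
by rewrite ffunE (negPf nt1) mulr0.
Qed.

Fact tw_mulDl to : left_distributive (@tw_mul to) +%R.
Proof.
move=> u v w; apply/ffunP=> r; rewrite !ffunE -big_split.
by apply: eq_bigr => t _; rewrite ffunE factionD mulrDl.
Qed.

Fact tw_mulDr to : right_distributive (@tw_mul to) +%R.
Proof.
move=> u v w; apply/ffunP=> r; rewrite !ffunE -big_split.
by apply: eq_bigr => t _; rewrite ffunE mulrDr.
Qed.

Fact tw_nonzero to : tw to 1%g 1 != 0.
Proof. by apply/eqP=> /ffunP/(_ 1%g)/eqP; rewrite !ffunE eqxx oner_eq0. Qed.

HB.instance Definition _ to := GRing.Zmodule_isNzRing.Build (twisted_ring to)
  (@tw_mulA to) (@tw_mul1l to) (@tw_mul1r to) (@tw_mulDl to) (@tw_mulDr to)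
  (@tw_nonzero to).

Fact tw_scaleAl to c (u v : twisted_ring to) : c *: (u * v) = (c *: u) * v.
Proof.
apply/ffunP=> r; rewrite !ffunE scaler_sumr; apply: eq_bigr => t _.
by rewrite ffunE factionZ scalerAl.
Qed.
HB.instance Definition _ to := GRing.Lmodule_isLalgebra.Build K
  (twisted_ring to) (@tw_scaleAl to).

Fact tw_scaleAr to c (u v : twisted_ring to) : c *: (u * v) = u * (c *: v).
Proof.
apply/ffunP=> r; rewrite !ffunE scaler_sumr; apply: eq_bigr => t _.
by rewrite ffunE scalerAr.
Qed.
HB.instance Definition _ to := GRing.Lalgebra_isAlgebra.Build K
  (twisted_ring to) (@tw_scaleAr to).

HB.instance Definition _ to := Algebra_isFalgebra.Build K (twisted_ring to).

Lemma tw_sum to (u : twisted_ring to) : u = \sum_s tw to s (u s).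
Proof.
apply/ffunP=> r; rewrite sum_ffunE (bigD1 r) //= ffunE eqxx big1 ?addr0 //.
by move=> s nsr; rewrite ffunE eq_sym (negPf nsr).
Qed.

Lemma tw_mulE to s t y z : tw to s y * tw to t z = tw to (s * t)%g (to y t * z).
Proof.
apply/ffunP=> r; rewrite !ffunE (bigD1 t) //= !ffunE eqxx big1 ?addr0.
  rewrite (canF_eq (mulgKV t)).
  by case: eqP => // _; rewrite faction0 mul0r.
by move=> q nqt; rewrite !ffunE (negPf nqt) mulr0.
Qed.

End TwistedGroupRing.

Section Modules.

Variables (K : fieldType) (A : falgType K).

Record rmodule := RModule {
  rmod_space :> vectType K;
  ract : rmod_space -> A -> rmod_space;
  ract_linearl : forall a, linear (ract^~ a);
  ract_linearr : forall x, linear (ract x);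
  ract1 : forall x, ract x 1 = x;
  ractM : forall x a b, ract x (a * b) = ract (ract x a) b
}.

Definition rmod_iso (X Y : rmodule) : Prop :=
  exists2 f : 'Hom(X, Y), bijective f
    & forall x a, f (ract x a) = ract (f x) a.

Definition submodule (X : rmodule) (U : {vspace X}) : Prop :=
  forall u a, u \in U -> ract u a \in U.

Definition simple_rmod (X : rmodule) : Prop :=
  {:X}%VS != 0%VS /\
  forall U : {vspace X}, submodule U -> U = 0%VS \/ U = {:X}%VS.

Record simple_rmodule := SimpleRModule {
  srmod :> rmodule;
  srmodP : simple_rmod srmod
}.

Variable X : simple_rmodule.

(* K-linear endomorphisms of X, with the product f * g = f \o g of maps       *)
(* acting from the left.                                                      *)
Definition lin_end : Type := 'End(X).

HB.instance Definition _ := Vector.copy lin_end 'End(X).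

Fact lin_end_nonzero : (\1%VF : lin_end) != 0.
Proof.
apply/eqP=> e; have [/negP[]] := srmodP X.
rewrite -subv0; apply/subvP=> x _; rewrite memv0; apply/eqP.
by rewrite -[x]id_lfunE (e : \1%VF = 0 :> 'End(X)) zero_lfunE.
Qed.

HB.instance Definition _ := GRing.Zmodule_isNzRing.Build lin_end
  (@comp_lfunA K X X X X) (@comp_lfun1l K X X) (@comp_lfun1r K X X)
  (@comp_lfunDl K X X X) (@comp_lfunDr K X X X) lin_end_nonzero.

Fact lin_end_scaleAl c (f g : lin_end) : c *: (f * g) = (c *: f) * g.
Proof. exact: comp_lfunZl. Qed.
HB.instance Definition _ :=
  GRing.Lmodule_isLalgebra.Build K lin_end lin_end_scaleAl.

Fact lin_end_scaleAr c (f g : lin_end) : c *: (f * g) = f * (c *: g).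
Proof. exact: comp_lfunZr. Qed.
HB.instance Definition _ :=
  GRing.Lalgebra_isAlgebra.Build K lin_end lin_end_scaleAr.

HB.instance Definition _ := Algebra_isFalgebra.Build K lin_end.

Definition operation (a : A) (x : X) : X := ract x a.

HB.instance Definition _ a :=
  GRing.isLinear.Build K X X *:%R (operation a) (@ract_linearl X a).

Definition ract_end (a : A) : lin_end := linfun (operation a).

Fact ract_end_linear : linear ract_end.
Proof.
move=> c a b; apply/lfunP=> x.
by rewrite add_lfunE scale_lfunE !lfunE; apply: ract_linearr.
Qed.
HB.instance Definition _ :=
  GRing.isLinear.Build K A lin_end *:%R ract_end ract_end_linear.

(* End_A X and End_(End_A X) X as centralisers in lin_end; see modendP and    *)
(* biendP below.                                                              *)
Definition modend_aspace : {aspace lin_end} := 'C(limg (linfun ract_end))%AS.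
Definition modend : falgType K := subvs_of modend_aspace.
Definition biend : {vspace lin_end} := 'C(modend_aspace)%VS.

Lemma modendP (f : lin_end) :
  reflect (forall x a, f (ract x a) = ract (f x) a) (f \in modend_aspace).
Proof.
apply: (iffP centvP) => [fC x a | fC _ /memv_imgP[a _ ->]].
  have /fC/lfunP/(_ x) : linfun ract_end a \in limg (linfun ract_end).
    exact: memv_img (memvf a).
  by rewrite !comp_lfunE !lfunE.
by apply/lfunP=> x; rewrite !comp_lfunE !lfunE; apply: fC.
Qed.

Lemma biendP (f : lin_end) :
  reflect (forall (k : modend) x, f (vsval k x) = vsval k (f x)) (f \in biend).
Proof.
apply: (iffP centvP) => [fC k x | fC g Cg].
  by have /fC/lfunP/(_ x) := subvsP k; rewrite !comp_lfunE.
by apply/lfunP=> x; rewrite !comp_lfunE; apply: (fC (Subvs Cg)).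
Qed.

Fact ract_end_biend a : ract_end a \in biend.
Proof.
by apply/biendP=> k x; rewrite !lfunE; apply/esym/modendP/subvsP.
Qed.

Definition omega (a : A) : subvs_of biend := Subvs (ract_end_biend a).

Lemma omegaE a x : vsval (omega a) x = ract x a.
Proof. exact: lfunE. Qed.

(* A basis of X as a left modend-space, together with the identification of X *)
(* with rows over modend that it yields.                                      *)
Record left_basis (m : nat) := LeftBasis {
  lb_vec : 'I_m -> X;
  lb_coord : X -> 'rV[modend]_m;
  lb_coordK : forall x, \sum_j vsval (lb_coord x 0 j) (lb_vec j) = x;
  lb_combK : forall r : 'rV[modend]_m,
    lb_coord (\sum_j vsval (r 0 j) (lb_vec j)) = r
}.

Definition end_mx m (b : left_basis m) (phi : lin_end) : 'M[modend]_m :=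
  \matrix_(i, j) lb_coord b (phi (lb_vec b i)) 0 j.

End Modules.

(* Main.v *)
Require Import Defs.
From HB Require Import structures.
From mathcomp Require Import all_boot all_order all_algebra all_fingroup all_field.

(* Put c_i = x_i d_i / h. Since n is invertible, lambda(a) = n Tr_{L/K}(a_1)    *)
(* is a symmetrizing form on A = L wr G, and u = sigma y_l / n and              *)
(* v = y*_l sigma^-1 run through dual bases for it. The Casimir element         *)
(* sum u (x) v commutes with A, and sum u z v = Tr(z) for z in L; a z of trace  *)
(* 1 (rather than the scalar h, which may vanish in K) makes averaging over the *)
(* Casimir element give Maschke's theorem, Schur orthogonality of distinct X_i, *)
(* and the density theorem.                                                     *)
(*   For a single X_i, extend scalars to a field F that splits K_i and contains *)
(* L. The matrices rho(A) span a full matrix ring over F, so the operator       *)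
(* Phi |-> sum tr(Phi rho(v)) rho(u) is a scalar, and this scalar times         *)
(* tr rho(z) is 1. Finally tr rho(z) = c_i: the idempotents through which L     *)
(* acts by its embeddings into F are permuted transitively by G, hence all have *)
(* the same rank c_i, even when K has characteristic dividing h.                *)

Set Implicit Arguments.
Unset Strict Implicit.
Unset Printing Implicit Defensive.

Import GRing.Theory.
Local Open Scope ring_scope.

(** The two composites are treated in turn. Applying [omega] at i to the claimed preimage of (phi_i)
    leaves a diagonal term, equal to phi_i by [inversion_diag], and terms from the other simple
    modules, which vanish by [schur_orthogonality]. Hence the preimage of omega(a) acts on every
    simple module as a does, and equals a by [annihilator0].

    The dual bases come from [tw_expand], [tw_expandV] and [tw_casimir], the field F from
    [ex_splitting_over]. Over F the diagonal term is [mx_casimir_scalar], with the constant given by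
    [trace_eigen]. The trace from the center of K_i down to K is absorbed inside [inversion_diag] by
    moving a K-basis of the center through the Casimir element. *)

Local Notation ract := Defs.ract.

(** * Matrices and traces *)

Lemma morphD_sum (U W : zmodType) (f : U -> W) (J : finType) (F : J -> U) :
  {morph f : a b / a + b} -> f (\sum_j F j) = \sum_j f (F j).
Proof.
move=> fD; apply: (big_morph f fD).
by apply: (addrI (f 0)); rewrite -fD !addr0.
Qed.

Lemma span_sum (F : fieldType) (V : lmodType F) (S I : Type) (g : S -> V)
    (r : seq I) (P : pred I) (G : I -> V) :
  (forall i, P i -> exists s : seq (F * S), G i = \sum_(p <- s) p.1 *: g p.2) ->
  exists s : seq (F * S),
    \sum_(i <- r | P i) G i = \sum_(p <- s) p.1 *: g p.2.
Proof.
move=> GP; apply: (big_ind (fun w => exists s : seq (F * S),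
  w = \sum_(p <- s) p.1 *: g p.2)) => //.
  by exists [::]; rewrite big_nil.
by move=> _ _ [s1 ->] [s2 ->]; exists (s1 ++ s2); rewrite big_cat.
Qed.

Lemma comm_mx_all_scalar (R : comNzRingType) n (A : 'M[R]_n) :
  (forall B : 'M[R]_n, A *m B = B *m A) -> exists c, A = c%:M.
Proof.
case: n A => [|n] A cA; first by exists 0; apply/matrixP=> - [].
exists (A 0 0); apply/matrixP=> i j.
have /matrixP/(_ i 0) := cA (delta_mx j 0).
rewrite !mxE (bigD1 j) //= big1 ?addr0 => [|k nkj]; last first.
  by rewrite mxE (negPf nkj) mulr0.
rewrite mxE !eqxx mulr1 => ->.
rewrite (bigD1 0) //= big1 ?addr0 => [|k nk0]; last first.
  by rewrite mxE (negPf nk0) andbF mul0r.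
by rewrite mxE eqxx andbT mulr_natl.
Qed.

(** In a rank factorization e = C R, idempotence forces R C = 1 by cancelling C on the left and R on
    the right; then tr e = tr (R C). *)
Lemma mxtrace_idem (F : fieldType) n (e : 'M[F]_n) :
  e *m e = e -> \tr e = (\rank e)%:R.
Proof.
move=> ee; suff base1 : row_base e *m col_base e = 1%:M.
  by rewrite -{1}(mulmx_base e) mxtrace_mulC base1 mxtrace1.
apply: (row_free_inj (row_base_free e)); rewrite /= mul1mx.
apply: (row_full_inj (col_base_full e)).
by rewrite -[row_base e *m _ *m _]mulmxA mulmx_base mulmxA mulmx_base ee.
Qed.

(** Orthogonality makes the row spaces independent, and they span everything because the idempotents
    sum to 1. *)
Lemma sum_rank_idem (F : fieldType) (I : finType) (P : pred I) n
    (e : I -> 'M[F]_n) :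
  (forall i j, P i -> P j -> e i *m e j = if i == j then e i else 0) ->
  \sum_(i | P i) e i = 1%:M -> (\sum_(i | P i) \rank (e i))%N = n.
Proof.
move=> eM e1.
have dx : mxdirect (\sum_(i | P i) e i).
  apply/mxdirect_sumsP=> i Pi; apply/eqP/rowV0P=> v.
  rewrite sub_capmx => /andP[/submxP[a ->] /sub_sumsmxP[w dv]].
  have : a *m e i *m e i = 0.
    rewrite dv mulmx_suml big1 // => j /andP[Pj nji].
    by rewrite -mulmxA eM // (negPf nji) mulmx0.
  by rewrite -mulmxA eM // eqxx.
rewrite -(mxdirectP dx) /=; apply/eqP; rewrite -[_ == n]/(row_full _) -sub1mx.
by rewrite -e1; apply: summx_sub_sums => i _.
Qed.

(** Lets traces on L be computed with the dual pair (y_l), (y*_l) or a conjugate of it instead of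
    the chosen [vbasis]. *)
Lemma endo_trace_frame (K : fieldType) (V : vectType K) (J : finType)
    (y : J -> V) (beta : J -> V -> K) (f : 'End(V)) :
  (forall j, linear (beta j : V -> K^o)) ->
  (forall w, w = \sum_j beta j w *: y j) ->
  endo_trace f = \sum_j beta j (f (y j)).
Proof.
move=> betaL yP; pose e := vbasis {:V}; have eB : basis_of {:V} e := vbasisP _.
have -> : endo_trace f = \sum_i coord e i (f e`_i).
  apply: eq_bigr => i _.
  by rewrite mxE /= passmx.vecof_delta mxE.
under eq_bigr => i _ do rewrite [f _]yP linear_sum.
rewrite exchange_big; apply: eq_bigr => j _ /=.
have betaD : {morph beta j : p q / p + q}.
  by move=> p q; have := betaL j 1 p q; rewrite !scale1r.
rewrite [X in f X](coord_basis eB (memvf (y j))) linear_sum (morphD_sum _ betaD).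
have beta0 : beta j 0 = 0 by apply: (addrI (beta j 0)); rewrite -betaD !addr0.
have betaZ c p : beta j (c *: p) = c * beta j p.
  by have := betaL j c p 0; rewrite !addr0 beta0 addr0.
by apply: eq_bigr => i _; rewrite !linearZ /= betaZ mulrC.
Qed.

(** * Modules over a finite-dimensional algebra *)

Definition hom_of (K : fieldType) (V W : vectType K) (f : V -> W)
    (fL : linear f) : 'Hom(V, W) :=
  linfun (HB.pack f (GRing.isLinear.Build K V W *:%R f fL) : {linear V -> W}).

Lemma hom_ofE (K : fieldType) (V W : vectType K) (f : V -> W) (fL : linear f) x :
  hom_of fL x = f x.
Proof. exact: lfunE. Qed.

Section RModules.

Variables (K : fieldType) (A : falgType K).
Implicit Types X Y : rmodule A.

Lemma ractDl X a : {morph (@ract K A X)^~ a : x y / x + y}.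
Proof. by move=> x y; have := ract_linearl a 1 x y; rewrite !scale1r. Qed.

Lemma ractDr X (x : X) : {morph ract x : a b / a + b}.
Proof. by move=> a b; have := ract_linearr x 1 a b; rewrite !scale1r. Qed.

Lemma ract0l X a : ract (0 : X) a = 0.
Proof. by apply: (addrI (ract (0 : X) a)); rewrite -ractDl !addr0. Qed.

Lemma ract0r X (x : X) : ract x 0 = 0.
Proof. by apply: (addrI (ract x 0)); rewrite -ractDr !addr0. Qed.

Lemma ractZl X a c (x : X) : ract (c *: x) a = c *: ract x a.
Proof. by have := ract_linearl a c x 0; rewrite !addr0 ract0l addr0. Qed.

Lemma ractZr X (x : X) c a : ract x (c *: a) = c *: ract x a.
Proof. by have := ract_linearr x c a 0; rewrite !addr0 ract0r addr0. Qed.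

Lemma ract_suml X (J : finType) (F : J -> X) a :
  ract (\sum_j F j) a = \sum_j ract (F j) a.
Proof. exact: morphD_sum (ractDl a). Qed.

Lemma ract_sumr X (x : X) (J : finType) (F : J -> A) :
  ract x (\sum_j F j) = \sum_j ract x (F j).
Proof. exact: morphD_sum (ractDr x). Qed.

Lemma ract_endE (X : simple_rmodule A) a (x : X) : ract_end X a x = ract x a.
Proof. exact: lfunE. Qed.

Lemma ract_endM (X : simple_rmodule A) a b :
  ract_end X (a * b) = (ract_end X b \o ract_end X a)%VF.
Proof. by apply/lfunP=> x; rewrite comp_lfunE !ract_endE ractM. Qed.

Definition rhom X Y (f : X -> Y) := forall x a, f (ract x a) = ract (f x) a.

Lemma submodule_ker X Y (f : 'Hom(X, Y)) : rhom f -> submodule (lker f).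
Proof. by move=> fM x a; rewrite !memv_ker fM => /eqP->; rewrite ract0l. Qed.

Lemma submodule_img X Y (f : 'Hom(X, Y)) : rhom f -> submodule (limg f).
Proof.
by move=> fM _ a /memv_imgP[x _ ->]; rewrite -fM memv_img ?memvf.
Qed.

Lemma simple_rhom_bij (X Y : simple_rmodule A) (f : 'Hom(X, Y)) :
  rhom f -> f != 0 -> bijective f.
Proof.
move=> fM nzf.
have [_ /(_ _ (submodule_ker fM)) kerf] := srmodP X.
have [_ /(_ _ (submodule_img fM)) imf] := srmodP Y.
have ker0 : lker f = 0%VS.
  case: kerf => // kerT; case/negP: nzf; apply/eqP/lfunP=> x.
  by rewrite zero_lfunE; apply/eqP; rewrite -memv_ker kerT memvf.
have imT : limg f = fullv.
  case: imf => // im0; case/negP: nzf; apply/eqP/lfunP=> x.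
  by rewrite zero_lfunE; apply/eqP; rewrite -memv0 -im0 memv_img ?memvf.
exists (f^-1)%VF => [|y]; first by apply: lker0_lfunK; rewrite ker0.
by apply: limg_lfunVK; rewrite imT memvf.
Qed.

Section Submodule.

Variables (X : rmodule A) (U : {vspace X}) (Usub : submodule U).

Definition sub_ract (x : subvs_of U) a : subvs_of U :=
  Subvs (Usub a (subvsP x)).

Fact sub_ract_linearl a : linear (sub_ract^~ a).
Proof. by move=> c x y; apply: val_inj; rewrite /= ract_linearl. Qed.

Fact sub_ract_linearr x : linear (sub_ract x).
Proof. by move=> c a b; apply: val_inj; rewrite /= ract_linearr. Qed.

Fact sub_ract1 x : sub_ract x 1 = x.
Proof. by apply: val_inj; rewrite /= ract1. Qed.

Fact sub_ractM x a b : sub_ract x (a * b) = sub_ract (sub_ract x a) b.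
Proof. by apply: val_inj; rewrite /= ractM. Qed.

Definition sub_rmodule : rmodule A :=
  RModule sub_ract_linearl sub_ract_linearr sub_ract1 sub_ractM.

End Submodule.

Definition minimal_submodule X (S : {vspace X}) :=
  S != 0%VS /\
  forall T : {vspace X}, submodule T -> (T <= S)%VS -> T = 0%VS \/ T = S.

Lemma sub_rmodule_simple X (S : {vspace X}) (Ssub : submodule S) :
  minimal_submodule S -> simple_rmod (sub_rmodule Ssub).
Proof.
case=> nzS Smin; split.
  by rewrite -dimv_eq0 dimvf /dim /= dimv_eq0.
move=> T Tsub; pose T' := (linfun vsval @: T)%VS.
have T'sub : submodule T'.
  move=> _ a /memv_imgP[x Tx ->]; rewrite lfunE /=.
  have -> : ract (vsval x) a = linfun vsval (sub_ract Ssub x a) by rewrite lfunE.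
  exact/memv_img/Tsub.
have inj : lker (linfun vsval : 'Hom(subvs_of S, X)) == 0%VS.
  by apply/lker0P=> x y; rewrite !lfunE; apply: val_inj.
have T'S : (T' <= S)%VS.
  by apply/subvP=> _ /memv_imgP[x _ ->]; rewrite lfunE subvsP.
have dimT' : \dim T' = \dim T by apply: limg_dim_eq; rewrite (eqP inj) capv0.
case: (Smin T' T'sub T'S) => T'E; [left | right]; apply/eqP.
  by rewrite -dimv_eq0 -dimT' T'E dimv0.
by rewrite eqEdim subvf -dimT' T'E dimvf leqnn.
Qed.

(* [classically] suffices here and below, the final goals being decidable
   equalities. *)
Lemma ex_minimal_submodule X (U : {vspace X}) :
  submodule U -> U != 0%VS ->
  classically (exists S : {vspace X},
    [/\ submodule S, (S <= U)%VS & minimal_submodule S]).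
Proof.
have [m] := ubnP (\dim U); elim: m U => // m IH U ltUm Usub nzU.
pose bad (T : {vspace X}) := [/\ submodule T, (T <= U)%VS, T != 0%VS & T != U].
apply: (classic_bind _ (@classic_pick _ bad)) => -[[T [Tsub TU nzT nTU]]|noT].
  have ltTm : (\dim T < m)%N.
    apply: leq_trans (_ : \dim T < \dim U)%N _; last by rewrite -ltnS.
    by rewrite ltnNge; apply: contra nTU => leUT; rewrite eqEdim TU.
  apply: (classic_bind _ (IH T ltTm Tsub nzT)) => -[S [Ssub ST Smin]].
  by apply: classicW; exists S; split=> //; apply: subv_trans TU.
apply: classicW; exists U; split=> //; split=> // T Tsub TU.
have [->|nzT] := eqVneq T 0%VS; first by left.
have [->|nTU] := eqVneq T U; first by right.
by case: (noT T).
Qed.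

(** Closed by [Defined], so that its action converts to the product of A. *)
Definition regular_rmodule : rmodule A.
Proof.
apply: (@RModule K A A *%R) => [a|a|a|a b c]; last exact: mulrA.
- by move=> c x y; rewrite mulrDl scalerAl.
- by move=> c x y; rewrite mulrDr scalerAr.
- exact: mulr1.
Defined.

Section Power.

Variables (X : rmodule A) (m : nat).

(** Powers of X serve [density], where an endomorphism is tested on a whole basis of X at once. *)
Definition pow_ract (x : {ffun 'I_m -> X}) a : {ffun 'I_m -> X} :=
  [ffun i => ract (x i) a].

Fact pow_ract_linearl a : linear (pow_ract^~ a).
Proof. by move=> c x y; apply/ffunP=> i; rewrite !ffunE ract_linearl. Qed.

Fact pow_ract_linearr x : linear (pow_ract x).
Proof. by move=> c a b; apply/ffunP=> i; rewrite !ffunE ract_linearr. Qed.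

Fact pow_ract1 x : pow_ract x 1 = x.
Proof. by apply/ffunP=> i; rewrite !ffunE ract1. Qed.

Fact pow_ractM x a b : pow_ract x (a * b) = pow_ract (pow_ract x a) b.
Proof. by apply/ffunP=> i; rewrite !ffunE ractM. Qed.

Definition pow_rmodule : rmodule A :=
  RModule pow_ract_linearl pow_ract_linearr pow_ract1 pow_ractM.

End Power.

End RModules.

(** * Symmetric algebras with a trace-one Casimir element *)

Section SymmetricAlgebra.

Variables (K : fieldType) (A : falgType K) (lam : A -> K).
Variables (J : finType) (u v : J -> A) (z : A).
Hypothesis lamC : forall a b, lam (a * b) = lam (b * a).
Hypothesis expu : forall a, a = \sum_j lam (v j * a) *: u j.
Hypothesis expv : forall a, a = \sum_j lam (a * u j) *: v j.
Hypothesis casz : \sum_j u j * z * v j = 1.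

Section Balanced.

Variables (W : zmodType) (Psi : A -> A -> W).
Hypothesis Dl : forall b, {morph Psi^~ b : x y / x + y}.
Hypothesis Dr : forall a, {morph Psi a : x y / x + y}.
Hypothesis bal : forall c a b, Psi (c *: a) b = Psi a (c *: b).

(** [Psi] plays the role of an additive map out of A tensor A over K. Expanding a u_j in the u_k and
    v_k a in the v_j produces the same coefficients lam(v_k a u_j). *)
Lemma casimirL a : \sum_j Psi (a * u j) (v j) = \sum_j Psi (u j) (v j * a).
Proof.
under eq_bigr => j _ do rewrite [a * u j]expu (morphD_sum _ (Dl _)).
rewrite exchange_big; apply: eq_bigr => k _ /=.
rewrite [v k * a]expv (morphD_sum _ (Dr _)).
by apply: eq_bigr => j _; rewrite bal mulrA.
Qed.

(** Same comparison of coefficients, where the symmetry of lam is what matches them. *)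
Lemma casimirR a : \sum_j Psi (u j * a) (v j) = \sum_j Psi (u j) (a * v j).
Proof.
under eq_bigr => j _ do rewrite [u j * a]expu (morphD_sum _ (Dl _)).
rewrite exchange_big; apply: eq_bigr => k _ /=.
rewrite [a * v k]expv (morphD_sum _ (Dr _)).
by apply: eq_bigr => j _; rewrite bal -mulrA [in RHS]lamC !mulrA.
Qed.

End Balanced.

Section Average.

Variables (X Y : rmodule A) (f : 'Hom(X, Y)).

(** The Casimir element applied to f; [casimirL] makes the result A-linear whatever the linear map f
    is. *)
Definition average (x : X) : Y := \sum_j ract (f (ract x (u j))) (v j).

Fact average_linear : linear average.
Proof.
move=> c x y; rewrite /average scaler_sumr -big_split; apply: eq_bigr => j _.
by rewrite /= ract_linearl linearP ract_linearl.
Qed.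

Lemma averageM : rhom average.
Proof.
move=> x a; pose Psi p q := ract (f (ract x p)) q.
have := @casimirL _ Psi _ _ _ a; rewrite /average ract_suml.
under eq_bigr do rewrite /Psi ractM.
under [in RHS]eq_bigr do rewrite /Psi ractM.
apply=> [b p q|b p q|c p q]; rewrite /Psi.
- by rewrite ractDr linearD ractDl.
- exact: ractDr.
- by rewrite ractZr linearZ ractZl ractZr.
Qed.

End Average.

(** The map averaged is the action of z followed by a linear projection onto U. On U the projection
    does nothing, and the average is x (sum u_j z v_j) = x. *)
Lemma maschke (X : rmodule A) (U : {vspace X}) : submodule U ->
  exists P : 'End(X), [/\ rhom P, forall x, P x \in U & {in U, P =1 id}].
Proof.
move=> Usub.
pose f := hom_of (ract_linearl z : linear ((@ract K A X)^~ z)).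
exists (hom_of (average_linear (projv U \o f)%VF)); split=> [x a|x|x Ux].
- by rewrite !hom_ofE averageM.
- rewrite hom_ofE; apply: rpred_sum => j _.
  by apply: Usub; rewrite comp_lfunE memv_proj.
rewrite hom_ofE -[RHS]ract1 -casz ract_sumr; apply: eq_bigr => j _.
rewrite comp_lfunE hom_ofE projv_id ?ractM //.
exact/Usub/Usub.
Qed.

(** If a is nonzero, the right ideal a A contains a minimal one S, with an A-linear projection P
    onto it. An element s = a b of S satisfies s = P(s) = P(1) a b, and P(1) a = 0 since P(1) lies
    in the simple module S. *)
Lemma annihilator0 (a : A) :
  (forall (S : simple_rmodule A) (x : S), ract x a = 0) -> a = 0.
Proof.
move=> a0; apply/eqP; apply: contraT => nza.
pose R := regular_rmodule A.
pose f : 'End(R) := hom_of (ract_linearr (a : R)).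
have fI x : ract (a : R) x \in limg f.
  by rewrite -(hom_ofE (ract_linearr _)) memv_img ?memvf.
have Usub : submodule (limg f).
  by move=> _ b /memv_imgP[x _ ->]; rewrite hom_ofE -ractM.
have nzU : limg f != 0%VS.
  apply: contra nza => /eqP U0; rewrite -memv0 -U0.
  by rewrite -[a](@ract1 K A R) fI.
apply: (ex_minimal_submodule Usub nzU) => -[S [Ssub SU Smin]].
pose M := SimpleRModule (sub_rmodule_simple Ssub Smin).
have [P [PM PS PK]] := maschke Ssub.
case: (Smin) => + _; case/negP; rewrite -subv0; apply/subvP=> s Ss.
rewrite memv0 -[s]PK //; have /subvP/(_ s Ss)/memv_imgP[b _ ->] := SU.
rewrite hom_ofE PM -[a : R](@mul1r A) -[1 * a]/(ract (1 : R) a) PM.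
have /(congr1 vsval) /= := a0 M (Subvs (PS 1)).
by move=> ->; rewrite mul0r.
Qed.

(** For a coordinate functional on X and a vector of Y, the average of the resulting rank-one map is
    a homomorphism from X to Y, so it is 0. Letting both vary kills the whole tensor sum of u_j on X
    and v_j on Y, hence its image under [psi]. *)
Lemma schur_orthogonality (X Y : simple_rmodule A)
    (psi : {linear lin_end Y -> K^o}) : ~ rmod_iso X Y ->
  \sum_j psi (ract_end Y (v j)) *: ract_end X (u j) = 0.
Proof.
move=> nXY; apply/lfunP=> x; rewrite zero_lfunE sum_lfunE.
apply/eqP; rewrite -[_ == 0]memv0; set w := \sum_j _.
have coord0 i : coord (vbasis {:X}) i w = 0.
  rewrite linear_sum /=.
  suff e0 : \sum_j coord (vbasis {:X}) i (ract x (u j)) *: ract_end Y (v j) = 0.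
    have := congr1 psi e0; rewrite linear0 linear_sum /= => {2}<-.
    apply: eq_bigr => j _.
    rewrite scale_lfunE !linearZ /= [RHS]mulrC.
    by congr (_ * coord _ i _); apply: ract_endE.
  apply/lfunP=> y; rewrite zero_lfunE sum_lfunE.
  have fL : linear (fun x' : X => coord (vbasis {:X}) i x' *: y).
    by move=> c p q; rewrite linearP scalerDl scalerA.
  have f0 : hom_of (average_linear (hom_of fL)) = 0.
    apply/eqP; apply: contraT => nzf; case: nXY.
    have fM : rhom (hom_of (average_linear (hom_of fL))).
      by move=> p a; rewrite !hom_ofE averageM.
    by exists (hom_of (average_linear (hom_of fL))); first exact: simple_rhom_bij.
  have /lfunP/(_ x) := f0; rewrite hom_ofE zero_lfunE => {2}<-.
  by apply: eq_bigr => j _; rewrite hom_ofE ractZl scale_lfunE ract_endE.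
rewrite (coord_vbasis (memvf w)) big1 ?mem0v // => i _.
by rewrite coord0 scale0r.
Qed.

(** Let e0 in X^m list a basis of X. The submodule e0 A has an A-linear projection P, whose matrix
    entries lie in End_A X. So phi, applied componentwise, commutes with P and keeps e0 inside e0 A:
    some a sends e0 to phi(e0). *)
Lemma density (X : simple_rmodule A) (phi : lin_end X) :
  phi \in biend X -> exists a, phi = ract_end X a.
Proof.
move/biendP=> phiC; pose e := vbasis {:X}; pose m : nat := \dim {:X}.
pose Y := pow_rmodule X m; pose e0 : Y := [ffun i : 'I_m => e`_i].
pose g : 'Hom(A, Y) := hom_of (ract_linearr e0).
have gI x : ract e0 x \in limg g.
  by rewrite -(hom_ofE (ract_linearr _)) memv_img ?memvf.
have Usub : submodule (limg g).
  by move=> _ b /memv_imgP[x _ ->]; rewrite hom_ofE -ractM.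
have [P [PM PS PK]] := maschke Usub.
pose inc j (x : X) : Y := [ffun i : 'I_m => if i == j then x else 0].
pose ent (i j : 'I_m) (x : X) : X := P (inc j x) i.
have entL i j : linear (ent i j).
  move=> c x y; rewrite /ent.
  have -> : inc j (c *: x + y) = c *: inc j x + inc j y.
    by apply/ffunP=> k; rewrite !ffunE; case: eqP; rewrite // scaler0 addr0.
  by rewrite linearP !ffunE.
have entC i j : (hom_of (entL i j) : lin_end X) \in modend_aspace X.
  apply/modendP=> x a; rewrite !hom_ofE /ent.
  have -> : inc j (ract x a) = ract (inc j x) a.
    by apply/ffunP=> k; rewrite !ffunE; case: eqP; rewrite ?ract0l.
  by rewrite PM ffunE.
have PE (w : Y) i : P w i = \sum_j ent i j (w j).
  have {1}-> : w = \sum_j inc j (w j).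
    apply/ffunP=> k; rewrite sum_ffunE (bigD1 k) //= ffunE eqxx.
    by rewrite big1 ?addr0 // => l nlk; rewrite ffunE eq_sym (negPf nlk).
  by rewrite linear_sum sum_ffunE.
pose phie : Y := [ffun i : 'I_m => phi (e`_i)].
have Pphi : P phie = phie.
  have Pe0 : P e0 = e0 by apply: PK; rewrite -[e0]ract1.
  apply/ffunP=> i; rewrite PE.
  have : phi (P e0 i) = phie i by rewrite Pe0 !ffunE.
  rewrite PE linear_sum => <-; apply: eq_bigr => j _.
  have := phiC (Subvs (entC i j)) (e0 j); rewrite /= !hom_ofE => ->.
  by rewrite !ffunE.
have /memv_imgP[a _ phiE] : phie \in limg g by rewrite -Pphi.
exists a; apply/lfunP=> x; rewrite ract_endE.
rewrite (coord_vbasis (memvf x)) linear_sum ract_suml; apply: eq_bigr => i _.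
rewrite linearZ ractZl; congr (_ *: _).
by have := congr1 (fun w : Y => w i) phiE; rewrite hom_ofE !ffunE.
Qed.

End SymmetricAlgebra.

(** * The trace form of L and the twisted group ring *)

Section AlgTrace.

Variables (K : fieldType) (A : falgType K).

Fact alg_trace_linear : linear (@alg_trace K A : A -> K^o).
Proof.
move=> c a b; rewrite /alg_trace /endo_trace amull_is_linear.
by rewrite passmx.mxof_linear linearP.
Qed.

HB.instance Definition _ :=
  GRing.isLinear.Build K A K^o *:%R (@alg_trace K A) alg_trace_linear.

Lemma alg_traceB (a b : A) : alg_trace (a - b) = alg_trace a - alg_trace b.
Proof. exact: (linearB (@alg_trace K A : {linear A -> K^o})). Qed.

Lemma alg_traceZ c (a : A) : alg_trace (c *: a) = c * alg_trace a.
Proof. exact: (linearZ_LR (@alg_trace K A : {linear A -> K^o})). Qed.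

Lemma alg_traceMn (a : A) m : alg_trace (a *+ m) = alg_trace a *+ m.
Proof. exact: (linearMn (@alg_trace K A : {linear A -> K^o})). Qed.

Lemma alg_trace_sum (I : finType) (F : I -> A) :
  alg_trace (\sum_i F i) = \sum_i alg_trace (F i).
Proof. exact: (linear_sum (@alg_trace K A : {linear A -> K^o})). Qed.

Lemma alg_trace_coord (a : A) :
  alg_trace a =
  \sum_i coord (vbasis {:A}) i (a * (vbasis {:A})`_i).
Proof.
rewrite [alg_trace a](@endo_trace_frame K A _
  (fun i : 'I_(\dim {:A}) => (vbasis {:A})`_i) (coord (vbasis {:A}))).
- by apply: eq_bigr => i _; rewrite lfunE.
- by move=> i c p q; rewrite linearP.
by move=> w; apply/coord_vbasis/memvf.
Qed.

End AlgTrace.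

Section FieldAction.

Variables (gT : finGroupType) (K : fieldType) (L : fieldExtType K).
Variables (to : field_action gT L) (n : nat).
Hypothesis n_def : n = #|action_kernel to|.
Hypothesis n_unit : (n%:R : K) \is a GRing.unit.

Local Notation N := (action_kernel to).
Local Notation Tr := (@alg_trace K L).

Lemma factionK s : cancel (to^~ s) (to^~ s^-1%g).
Proof. by move=> w; rewrite -faction_mulg mulgV faction_id. Qed.

Lemma factionKV s : cancel (to^~ s^-1%g) (to^~ s).
Proof. by move=> w; rewrite -faction_mulg mulVg faction_id. Qed.

Lemma group_set_action_kernel : group_set N.
Proof.
apply/group_setP; split=> [|s t]; first exact/action_kernelP/faction_id.
move=> /action_kernelP sN /action_kernelP tN; apply/action_kernelP=> w.
by rewrite faction_mulg sN tN.
Qed.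
Canonical action_kernel_group := Group group_set_action_kernel.

(** One representative for each automorphism of L induced by G. *)
Definition kernel_transversal := [set s | repr (N :* s)%g == s].
Local Notation T := kernel_transversal.

Lemma kernel_transversal_inj s t :
  s \in T -> t \in T -> (s * t^-1 \in N)%g = (s == t).
Proof.
rewrite [s \in T]inE [t \in T]inE => /eqP sT /eqP tT; rewrite -mem_rcoset.
apply/idP/eqP => [/rcoset_eqP e|->]; last exact: rcoset_refl.
by rewrite -sT e tT.
Qed.

Lemma sum_kernel_transversal (W : zmodType) (f : gT -> W) :
  (forall r s, r \in N -> f (r * s)%g = f s) ->
  \sum_s f s = (\sum_(s in T) f s) *+ n.
Proof.
move=> fN; rewrite -sumrMnl.
rewrite (partition_big (fun s => repr (N :* s)%g) (mem T)) /=; last first.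
  move=> s _; rewrite inE; apply/eqP; congr (repr _).
  exact/rcoset_eqP/mem_repr_rcoset.
apply: eq_bigr => t; rewrite inE => /eqP tT.
rewrite (eq_bigl (mem (N :* t)%g)) => [|s]; last first.
  rewrite /=; apply/eqP/rcoset_eqP => [<-|->]; last by [].
  exact/esym/rcoset_eqP/mem_repr_rcoset.
rewrite (eq_bigr (fun=> f t)) => [|s /rcosetP[r rN ->]]; last exact: fN.
by rewrite sumr_const n_def card_rcoset.
Qed.

Variables (h : nat) (y ystar : 'I_h -> L).
Hypothesis y_span : forall w, exists c : 'I_h -> K, w = \sum_l c l *: y l.
Hypothesis dual : forall l m, Tr (y l * ystar m) = (l == m)%:R.
Hypothesis h_gt0 : (0 < h)%N.

Let l0 : 'I_h := Ordinal h_gt0.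

Definition unit_trace_elt := y l0 * ystar l0.
Local Notation z := unit_trace_elt.

Lemma unit_trace_eltP : Tr z = 1.
Proof. by rewrite dual eqxx. Qed.

Lemma dual_expand w : w = \sum_l Tr (w * ystar l) *: y l.
Proof.
have [c wE] := y_span w; rewrite {1}wE; apply: eq_bigr => l _.
rewrite wE mulr_suml alg_trace_sum (bigD1 l) //= big1 ?addr0 => [|m nml].
  by rewrite -scalerAl alg_traceZ dual eqxx mulr1.
by rewrite -scalerAl alg_traceZ dual (negPf nml) mulr0.
Qed.

(** A nonzero such w would give Tr = 0 on L w = L, against Tr z = 1. *)
Lemma trace_nondeg w : (forall l, Tr (y l * w) = 0) -> w = 0.
Proof.
move=> w0; apply/eqP; apply: contraT => nzw.
have Tr0 v : Tr v = 0.
  rewrite -(mulfVK nzw v) [v / w]dual_expand mulr_suml alg_trace_sum big1 //.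
  by move=> l _; rewrite -scalerAl alg_traceZ w0 mulr0.
by have := unit_trace_eltP; rewrite Tr0 => /esym/eqP; rewrite oner_eq0.
Qed.

Lemma dual_expandV w : w = \sum_l Tr (y l * w) *: ystar l.
Proof.
apply/eqP; rewrite -subr_eq0; apply/eqP/trace_nondeg => m.
rewrite mulrBr alg_traceB mulr_sumr alg_trace_sum (bigD1 m) //= big1 => [|l nlm].
  by rewrite -scalerAr alg_traceZ dual eqxx mulr1 addr0 subrr.
by rewrite -scalerAr alg_traceZ dual eq_sym (negPf nlm) mulr0.
Qed.

(** Pairing the sum with y_m gives the trace of multiplication by y_m, computed in the dual frame,
    so the difference from 1 is orthogonal to every y_m. *)
Lemma sum_dual : \sum_l y l * ystar l = 1.
Proof.
apply/eqP; rewrite -subr_eq0; apply/eqP/trace_nondeg => m.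
rewrite mulrBr mulr1 alg_traceB mulr_sumr alg_trace_sum /=.
rewrite [X in _ - X](@endo_trace_frame K L _ y (fun l w => Tr (w * ystar l))).
- by rewrite -sumrB big1 // => l _; rewrite lfunE /= mulrA subrr.
- by move=> l c a b; rewrite mulrDl -scalerAl alg_trace_linear.
exact: dual_expand.
Qed.

(** The trace of multiplication by w^s, computed in the conjugate frame (y_l^s), is that of w in the
    frame (y_l). *)
Lemma trace_faction s w : Tr (to w s) = Tr w.
Proof.
rewrite [Tr (to w s)](@endo_trace_frame K L _ (fun l => to (y l) s)
  (fun l v => Tr (to v s^-1%g * ystar l))).
- rewrite -[RHS]/(Tr w) -[w in RHS]mulr1 -sum_dual mulr_sumr alg_trace_sum.
  by apply: eq_bigr => l _; rewrite lfunE /= -factionM factionK mulrA.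
- by move=> l c a b; rewrite factionD factionZ mulrDl -scalerAl alg_trace_linear.
move=> v; rewrite -{1}[v](factionKV s) {1}[to v _]dual_expand faction_sum.
by apply: eq_bigr => l _; rewrite factionZ.
Qed.

(** Let c be the sum. Expanding w y_l in the y_m, then regrouping to w y*_m, gives w^s c = w c for
    all w; so c = 0 unless s acts trivially. *)
Lemma sum_dual_faction s :
  \sum_l to (y l) s * ystar l = (s \in N)%:R.
Proof.
case: action_kernelP => [sN | nsN].
  by under eq_bigr do rewrite sN; rewrite sum_dual.
apply/eqP; apply: contraT => nz; case: nsN => w; apply: (mulIf nz).
rewrite mulr_sumr mulr_sumr.
under eq_bigr do rewrite mulrA -factionM [w * y _]dual_expand faction_sum mulr_suml.
rewrite exchange_big; apply: eq_bigr => m _ /=.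
rewrite mulrCA [w * ystar m]dual_expandV mulr_sumr; apply: eq_bigr => l _.
by rewrite factionZ -scalerAl -scalerAr [in RHS]mulrCA mulrA.
Qed.

Lemma sum_dual_faction2 s t :
  \sum_l to (y l) s * to (ystar l) t = (s * t^-1 \in N)%g%:R.
Proof.
rewrite -[RHS](factionKV t).
have -> : to ((s * t^-1)%g \in N)%:R t^-1%g = (s * t^-1 \in N)%g%:R.
  by case: (_ \in N); rewrite ?faction1 ?faction0.
rewrite -sum_dual_faction faction_sum; apply: eq_bigr => l _.
by rewrite factionM -faction_mulg mulgKV.
Qed.

(** The sum f_l of the y_l^s is fixed by G, so lies in K. By [sum_dual_faction], the f_l y*_l add up
    to n; multiplying by y_m and taking traces gives f_m = n Tr y_m. *)
Lemma sum_faction w : \sum_s to w s = (n%:R * Tr w)%:A.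
Proof.
have fixed v : exists c, \sum_s to v s = c%:A.
  apply/vlineP/(faction_fixed to _).1 => t.
  rewrite faction_sum (reindex_inj (mulIg t^-1%g)) /=; apply: eq_bigr => s _.
  by rewrite -faction_mulg mulgKV.
have sumD : \sum_l (\sum_s to (y l) s) * ystar l = n%:R :> L.
  under eq_bigr do rewrite mulr_suml.
  rewrite exchange_big; under eq_bigr do rewrite sum_dual_faction.
  by rewrite -natr_sum n_def -sum1_card [in RHS]big_mkcond.
have sumy m : \sum_s to (y m) s = (n%:R * Tr (y m))%:A.
  have [c yc] := fixed (y m); rewrite yc; congr (_ *: _).
  have : Tr ((\sum_l (\sum_s to (y l) s) * ystar l) * y m) = c.
    rewrite mulr_suml alg_trace_sum (bigD1 m) //= yc big1 ?addr0 => [|l nlm].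
      by rewrite mulr_algl -scalerAl alg_traceZ [ystar m * _]mulrC dual eqxx mulr1.
    have [c' ->] := fixed (y l).
    rewrite mulr_algl -scalerAl alg_traceZ [ystar l * _]mulrC dual eq_sym.
    by rewrite (negPf nlm) mulr0.
  by rewrite sumD mulr_natl alg_traceMn mulr_natl => ->.
rewrite {1}[w]dual_expand.
under eq_bigr do rewrite faction_sum.
rewrite exchange_big /=.
under eq_bigr do (under eq_bigr do rewrite factionZ).
under eq_bigr do rewrite -scaler_sumr sumy scalerA.
rewrite -scaler_suml; congr (_ *: _).
rewrite [w in RHS]dual_expand alg_trace_sum mulr_sumr; apply: eq_bigr => l _.
by rewrite alg_traceZ mulrCA.
Qed.

(** The matrices (y_l^s) and (y*_l^s), s in T, are inverse to each other on both sides, hence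
    square. *)
Lemma card_kernel_transversal : #|T| = h.
Proof.
have n_neq0 : (n%:R : L) != 0.
  by rewrite -(rmorph_nat (in_alg L)) fmorph_eq0 -unitfE; apply: n_unit.
pose e (i : 'I_#|T|) : gT := enum_val i.
have eT i : e i \in T by apply: enum_valP.
pose M := \matrix_(i < #|T|, l < h) to (y l) (e i).
pose M' := \matrix_(l < h, i < #|T|) to (ystar l) (e i).
have MM' : M *m M' = 1%:M.
  apply/matrixP=> i j; rewrite !mxE; under eq_bigr do rewrite !mxE.
  by rewrite sum_dual_faction2 kernel_transversal_inj // (inj_eq enum_val_inj).
have M'M : M' *m M = 1%:M.
  apply/matrixP=> l m; rewrite !mxE; under eq_bigr do rewrite !mxE.
  rewrite -(@big_enum_val _ _ _ _ (mem T) (fun s => to (ystar l) s * to (y m) s)) /=.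
  apply: (mulfI n_neq0); rewrite mulr_natl -sum_kernel_transversal.
    under eq_bigr do rewrite -factionM; rewrite sum_faction [ystar l * _]mulrC dual.
    rewrite eq_sym; case: (_ == _); rewrite ?mulr1 ?mulr0 ?scale0r //.
    exact: (rmorph_nat (in_alg L)).
  by move=> r s /action_kernelP rN; rewrite !faction_mulg !rN.
by apply/eqP; rewrite eqn_leq (mulmx1_min MM') (mulmx1_min M'M).
Qed.

(** * The twisted group ring as a symmetric algebra *)

Local Notation A := (twisted_ring to).

Lemma twD s : {morph tw to s : a b / a + b}.
Proof.
by move=> a b; apply/ffunP=> r; rewrite !ffunE; case: eqP; rewrite ?addr0.
Qed.

Lemma twZ s c a : tw to s (c *: a) = c *: tw to s a.
Proof. by apply/ffunP=> r; rewrite !ffunE; case: eqP; rewrite ?scaler0. Qed.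

Lemma tw1 : tw to 1%g 1 = 1.
Proof. by []. Qed.

Lemma tw_conj w s : tw to 1%g w * tw to s 1 = tw to s (to w s).
Proof. by rewrite tw_mulE mul1g mulr1. Qed.

Lemma tw_split w s : tw to s w = tw to s 1 * tw to 1%g w.
Proof. by rewrite tw_mulE mulg1 faction1 mul1r. Qed.

(** The factor n cancels against that of [tw_basis], so duality is unaffected, while [tw_casimir]
    gets the value 1. *)
Definition tw_form (a : A) : K := n%:R * Tr (a 1%g).

Definition tw_basis (j : gT * 'I_h) : A := n%:R^-1 *: tw to j.1 (y j.2).

Definition tw_dual (j : gT * 'I_h) : A :=
  tw to 1%g (ystar j.2) * tw to j.1^-1%g 1.

Lemma tw_mul_at1 (a b : A) : (a * b) 1%g = \sum_t to (a t^-1%g) t * b t.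
Proof. by rewrite ffunE; under eq_bigr do rewrite mul1g. Qed.

Lemma tw_formC (a b : A) : tw_form (a * b) = tw_form (b * a).
Proof.
rewrite /tw_form !tw_mul_at1 !alg_trace_sum; congr (_ * _) => /=.
rewrite [RHS](reindex_inj invg_inj) /=; apply: eq_bigr => t _.
by rewrite -[RHS](trace_faction t) factionM factionKV invgK mulrC.
Qed.

Lemma tw_expand (a : A) : a = \sum_j tw_form (tw_dual j * a) *: tw_basis j.
Proof.
rewrite {1}[a]tw_sum -(pair_bigA _ (fun s l =>
  tw_form (tw_dual (s, l) * a) *: tw_basis (s, l))) /=.
apply: eq_bigr => s _; rewrite {1}[a s]dual_expand (morphD_sum _ (twD s)).
apply: eq_bigr => l _; rewrite twZ scalerA /tw_form.
rewrite mulrAC mulfV ?mul1r -?unitfE //; congr (Tr _ *: _).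
rewrite tw_mul_at1 /tw_dual /= (bigD1 s) //= big1 ?addr0 => [|t nts].
  by rewrite tw_conj ffunE eqxx factionKV mulrC.
by rewrite tw_conj ffunE (inj_eq invg_inj) (negPf nts) faction0 mul0r.
Qed.

Lemma tw_expandV (a : A) : a = \sum_j tw_form (a * tw_basis j) *: tw_dual j.
Proof.
rewrite {1}[a]tw_sum -(pair_bigA _ (fun s l =>
  tw_form (a * tw_basis (s, l)) *: tw_dual (s, l))) /=.
rewrite (reindex_inj invg_inj) /=; apply: eq_bigr => s _.
rewrite -{1}[a _](factionK s) -tw_conj {1}[to _ s]dual_expandV.
rewrite (morphD_sum _ (twD _)) mulr_suml; apply: eq_bigr => l _.
rewrite twZ -scalerAl; congr (_ *: _); rewrite /tw_form.
rewrite tw_mul_at1 (bigD1 s) //= big1 ?addr0 => [|t nts].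
  by rewrite !ffunE /= eqxx -scalerAr alg_traceZ mulrA mulfV ?mul1r -?unitfE // mulrC.
by rewrite !ffunE /= (negPf nts) scaler0 mulr0.
Qed.

(** For fixed s, [sum_dual] collapses the sum over l to the conjugate of z under s^-1, divided by n.
    Summing over s yields Tr z = 1. *)
Lemma tw_casimir : \sum_j tw_basis j * tw to 1%g z * tw_dual j = 1.
Proof.
rewrite -(pair_bigA _ (fun s l =>
  tw_basis (s, l) * tw to 1%g z * tw_dual (s, l))) /=.
have row s : \sum_l tw_basis (s, l) * tw to 1%g z * tw_dual (s, l) =
    n%:R^-1 *: tw to 1%g (to z s^-1%g).
  rewrite -[z in RHS]mul1r -sum_dual mulr_suml faction_sum (morphD_sum _ (twD _)).
  rewrite scaler_sumr; apply: eq_bigr => l _.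
  rewrite /tw_basis /tw_dual -!scalerAl; congr (_ *: _).
  rewrite !tw_mulE !mul1g !mulg1 mulgV !mulr1 faction_id -factionM.
  by congr (tw to _ (to _ _)); rewrite mulrAC.
under eq_bigr do rewrite row.
rewrite -scaler_sumr -(morphD_sum _ (twD 1%g)) (reindex_inj invg_inj) /=.
under eq_bigr do rewrite invgK; rewrite sum_faction unit_trace_eltP mulr1.
by rewrite twZ scalerA mulVf -?unitfE // scale1r tw1.
Qed.

End FieldAction.

(** * A field containing a splitting field and L *)

Section Separability.

Variables (gT : finGroupType) (K : fieldType) (L : fieldExtType K).
Variable to : field_action gT L.

Fact faut_monoid_morphism s : monoid_morphism (faut to s).
Proof. by split; [apply: faction1 | apply: factionM]. Qed.
HB.instance Definition _ s :=
  GRing.isMonoidMorphism.Build L L (faut to s) (faut_monoid_morphism s).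

(** Each w is a root of the product of X - c over its distinct conjugates c, which G permutes. *)
Lemma faction_separable : separable 1 {:L}.
Proof.
apply/separableP=> w _; apply/separable_elementP.
pose r := undup [seq to w s | s : gT].
have rP c : reflect (exists s, c = to w s) (c \in r).
  rewrite mem_undup; apply: (iffP codomP) => -[s ->]; by exists s.
exists (\prod_(c <- r) ('X - c%:P)); split; last 2 first.
- by rewrite root_prod_XsubC; apply/rP; exists 1%g; rewrite faction_id.
- by rewrite separable_prod_XsubC undup_uniq.
apply/polyOverP=> i; apply/(faction_fixed to _).1 => s.
rewrite -[to _ s]/(faut to s _) -coef_map rmorph_prod; congr (_`_i).
rewrite (eq_bigr (fun c => 'X - (to c s)%:P)) => [|c _]; last first.
  by rewrite rmorphB /= map_polyX map_polyC.
transitivity (\prod_(c <- [seq to c s | c <- r]) ('X - c%:P)); first by rewrite big_map.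
rewrite (perm_big r) //; apply: uniq_perm; rewrite ?undup_uniq //.
  by rewrite map_inj_uniq ?undup_uniq //; apply: can_inj (factionK to s).
move=> c; apply/mapP/rP => [[_ /rP[t ->] ->]|[t ->]].
  by exists (t * s)%g; rewrite faction_mulg.
exists (to w (t * s^-1)%g); first by apply/rP; exists (t * s^-1)%g.
by rewrite -faction_mulg mulgKV.
Qed.

End Separability.

Lemma ex_irreducible_factor (E : fieldType) (p : {poly E}) :
  (1 < size p)%N ->
  classically (exists q, irreducible_poly q /\ q %| p).
Proof.
have [m] := ubnP (size p); elim: m p => // m IH p lepm p_gt1.
pose bad q := [/\ q %| p, size q != 1%N & ~~ (q %= p)].
apply: (classic_bind _ (@classic_pick _ bad)) => -[[q [qp q1 nqp]]|nobad].
  have p0 : p != 0 by rewrite -size_poly_gt0 ltnW.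
  have q0 : q != 0 by apply: dvdpN0 p0.
  have ltqp : (size q < size p)%N.
    rewrite ltn_neqAle dvdp_leq // andbT; apply: contra nqp => /eqP e.
    by rewrite -dvdp_size_eqp ?e.
  apply: (classic_bind _ (IH q _ _)) => [[r [irr rq]]||].
  - by apply: classicW; exists r; split=> //; apply: dvdp_trans qp.
  - exact: leq_trans ltqp _.
  by rewrite ltn_neqAle eq_sym q1 size_poly_gt0.
apply: classicW; exists p; split=> //; split=> // q q1 qp.
by apply: contraT => nqp; case: (nobad q).
Qed.

(** Write L = K(th) and adjoin to E a root [al] of an irreducible factor of the image of the minimal
    polynomial of th. Then p(th) determines p(al), and this assignment is the embedding of L. *)
Lemma compositum (K : fieldType) (L : fieldExtType K) (E : fieldType)
    (j : {rmorphism K -> E}) : separable 1 {:L} ->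
  classically (exists (F : fieldType) (iE : {rmorphism E -> F})
    (iL : {rmorphism L -> F}), forall c, iE (j c) = iL c%:A).
Proof.
move=> sepL; pose th := separable_generator 1 (fullv : {vspace L}).
have Lth : <<1; th>>%VS = fullv by rewrite -eq_adjoin_separable_generator ?sub1v.
have /polyOver1P[f mE] := minPolyOver 1 th.
have f_gt1 : (1 < size (map_poly j f))%N.
  rewrite size_map_poly -(size_map_poly (in_alg L)) -mE size_minPoly.
  by rewrite ltnS.
apply: (classic_bind _ (ex_irreducible_factor f_gt1)) => -[q [irr qf]].
have [F _ [al root_q _]] := irredp_FAdjoin irr.
pose k : {rmorphism K -> F} := in_alg F \o j.
have root_f : root (map_poly k f) al.
  by rewrite map_poly_comp; apply: root_dvdp root_q; rewrite dvdp_map.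
pose ev (p : {poly K}) := (map_poly (in_alg L) p).[th].
pose ev' (p : {poly K}) := (map_poly k p).[al].
have ev_surj w : exists p, ev p == w.
  have /polyOver1P[p pE] := Fadjoin_polyOver 1 th w.
  by exists p; rewrite /ev -pE Fadjoin_poly_eq ?Lth ?memvf.
have ev_eq p p' : ev p = ev p' -> ev' p = ev' p'.
  move=> e; apply/eqP; rewrite -subr_eq0 -hornerN -hornerD -rmorphB.
  apply: root_dvdp root_f; rewrite dvdp_map -(dvdp_map (in_alg L)) -mE.
  apply: minPoly_dvdp; first by apply/polyOver1P; exists (p - p').
  by rewrite rootE rmorphB hornerD hornerN subr_eq0; apply/eqP.
pose pol w := xchoose (ev_surj w).
have polK w : ev (pol w) = w by apply/eqP/(xchooseP (ev_surj w)).
pose v w := ev' (pol w).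
have vD : zmod_morphism v.
  move=> a b; rewrite /v /ev' -hornerN -hornerD -rmorphB.
  by apply: ev_eq; rewrite polK /ev rmorphB hornerD hornerN -!/(ev _) !polK.
have vM : monoid_morphism v.
  split=> [|a b].
    rewrite /v (ev_eq _ 1) ?polK /ev' /ev ?rmorph1 ?hornerE //.
  rewrite /v /ev' -hornerM -rmorphM.
  by apply: ev_eq; rewrite polK /ev rmorphM hornerM -!/(ev _) !polK.
pose iL : {rmorphism L -> F} := HB.pack v
  (GRing.isZmodMorphism.Build L F v vD) (GRing.isMonoidMorphism.Build L F v vM).
apply: classicW; exists F, (in_alg F), iL => c.
transitivity (ev' c%:P); first by rewrite /ev' map_polyC hornerC.
by apply: ev_eq; rewrite polK /ev map_polyC hornerC.
Qed.

Lemma mx_monoid_morphism (R S : comNzRingType) (f : {rmorphism R -> S})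
    (D : pzRingType) n (g : {rmorphism D -> 'M[R]_n}) :
  monoid_morphism (fun a => map_mx f (g a)).
Proof.
split=> [|a b]; first by rewrite rmorph1 map_mx1.
by rewrite rmorphM; apply: map_mxM.
Qed.

Lemma mx_zmod_morphism (R S : comNzRingType) (f : {rmorphism R -> S})
    (D : pzRingType) n (g : {rmorphism D -> 'M[R]_n}) :
  zmod_morphism (fun a => map_mx f (g a)).
Proof. by move=> a b; rewrite rmorphB map_mxB. Qed.

(** The given splitting is extended to a compositum with L; the image still spans, since the matrix
    units over F already come from the smaller field. *)
Lemma ex_splitting_over (K : fieldType) (L : fieldExtType K) (D : falgType K)
    d (trd : D -> subvs_of (alg_center D)) :
  separable 1 {:L} -> is_reduced_trace d trd ->
  classically (exists (F : fieldType)
    (iZ : {rmorphism subvs_of (alg_center D) -> F})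
    (rep : {rmorphism D -> 'M[F]_d}) (iL : {rmorphism L -> F}),
    [/\ forall z, rep (vsval z) = (iZ z)%:M,
        forall M, exists s : seq (F * D), M = \sum_(p <- s) p.1 *: rep p.2,
        forall a, iZ (trd a) = \tr (rep a)
      & forall c : K, iZ c%:A = iL c%:A]).
Proof.
move=> sepL [S trdE].
pose j : {rmorphism K -> split_field S} :=
  split_inj S \o in_alg (subvs_of (alg_center D)).
apply: (classic_bind _ (compositum (j := j) sepL)) => -[F [iE [iL iEL]]].
pose r a := map_mx iE (split_rep S a).
pose rep : {rmorphism D -> 'M[F]_d} := HB.pack r
  (GRing.isZmodMorphism.Build D 'M[F]_d r (mx_zmod_morphism iE (split_rep S)))
  (GRing.isMonoidMorphism.Build D 'M[F]_d r (mx_monoid_morphism iE (split_rep S))).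
apply: classicW; exists F, (iE \o split_inj S), rep, iL; split=> [z|M|a|c].
- by rewrite /rep /= /r split_repZ map_scalar_mx.
- have spanD (i k : 'I_d) (c : F) : exists s : seq (F * D),
      c *: delta_mx i k = \sum_(p <- s) p.1 *: rep p.2.
    have [s sE] := split_span (delta_mx i k : 'M[split_field S]_d).
    exists [seq (c * iE p.1, p.2) | p <- s].
    rewrite big_map -(map_delta_mx iE) sE map_mx_sum scaler_sumr.
    by apply: eq_bigr => p _; rewrite map_mxZ scalerA.
  rewrite [M]matrix_sum_delta.
  by apply: span_sum => i _; apply: span_sum.
- by rewrite /= trdE /r /mxtrace rmorph_sum; apply: eq_bigr => i _; rewrite mxE.
exact: iEL.
Qed.

(** * Matrix representations *)

Section CasimirMatrix.

Variables (K : fieldType) (A : falgType K) (lam : A -> K).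
Variables (J : finType) (u v : J -> A) (z : A).
Hypothesis lamC : forall a b, lam (a * b) = lam (b * a).
Hypothesis expu : forall a, a = \sum_j lam (v j * a) *: u j.
Hypothesis expv : forall a, a = \sum_j lam (a * u j) *: v j.
Hypothesis casz : \sum_j u j * z * v j = 1.

Variables (F : fieldType) (r : nat) (kappa : K -> F).
Variable rho : {rmorphism A -> 'M[F]_r}.
Hypothesis rhoA : forall c, rho c%:A = (kappa c)%:M.
Hypothesis rho_span : forall M : 'M[F]_r,
  exists s : seq (F * A), M = \sum_(p <- s) p.1 *: rho p.2.

Lemma rhoZ c a : rho (c *: a) = kappa c *: rho a.
Proof. by rewrite -mulr_algl rmorphM rhoA -mul_scalar_mx. Qed.

(** The operator G commutes with left and right multiplication by rho(A), hence by all matrices, so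
    it is a scalar c. Reading off entries, sum U_j Y V_j = c tr(Y), and Y = rho(z) gives c tr(rho z)
    = 1. *)
Lemma mx_casimir_scalar (Phi : 'M[F]_r) :
  \tr (rho z) *: (\sum_j \tr (Phi *m rho (v j)) *: rho (u j)) = Phi.
Proof.
pose G (P : 'M[F]_r) := \sum_j \tr (P *m rho (v j)) *: rho (u j).
have GZ c P : G (c *: P) = c *: G P.
  rewrite scaler_sumr; apply: eq_bigr => j _.
  by rewrite -scalemxAl mxtraceZ scalerA.
have GD P Q : G (P + Q) = G P + G Q.
  rewrite -big_split; apply: eq_bigr => j _ /=.
  by rewrite mulmxDl mxtraceD scalerDl.
have G0 : G 0 = 0 by have := GZ 0 0; rewrite scale0r scale0r.
have Gsum (s : seq (F * A)) (f : F * A -> 'M[F]_r) :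
    G (\sum_(p <- s) f p) = \sum_(p <- s) G (f p).
  exact: (big_morph G GD G0).
have Gl a P : G (rho a *m P) = rho a *m G P.
  pose Psi p q := \tr (P *m rho q) *: rho p.
  have := @casimirL _ _ _ _ _ _ expu expv _ Psi _ _ _ a.
  rewrite /Psi => /(_ _ _ _) e; rewrite mulmx_sumr.
  under [RHS]eq_bigr => j _ do
    rewrite -scalemxAr -[rho a *m _]/(rho a * rho (u j)) -rmorphM.
  rewrite e => [|b p q|b p q|c p q].
  - apply: eq_bigr => j _; rewrite rmorphM -[rho (v j) * _]/(rho (v j) *m rho a).
    by rewrite -mulmxA mxtrace_mulC mulmxA.
  - by rewrite rmorphD scalerDr.
  - by rewrite rmorphD mulmxDr mxtraceD scalerDl.
  by rewrite !rhoZ -scalemxAr mxtraceZ scalerA mulrC.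
have Gr a P : G (P *m rho a) = G P *m rho a.
  pose Psi p q := \tr (P *m rho q) *: rho p.
  have := @casimirR _ _ _ _ _ _ lamC expu expv _ Psi _ _ _ a.
  rewrite /Psi => /(_ _ _ _) e; rewrite mulmx_suml.
  under [RHS]eq_bigr => j _ do
    rewrite -scalemxAl -[_ *m rho a]/(rho (u j) * rho a) -rmorphM.
  rewrite e => [|b p q|b p q|c p q].
  - apply: eq_bigr => j _; rewrite rmorphM -[rho a * _]/(rho a *m rho (v j)).
    by rewrite mulmxA.
  - by rewrite rmorphD scalerDr.
  - by rewrite rmorphD mulmxDr mxtraceD scalerDl.
  by rewrite !rhoZ -scalemxAr mxtraceZ scalerA mulrC.
have Gl' W P : G (W *m P) = W *m G P.
  have [s ->] := rho_span W; rewrite !mulmx_suml Gsum.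
  by apply: eq_bigr => p _; rewrite -!scalemxAl GZ Gl.
have Gr' W P : G (P *m W) = G P *m W.
  have [s ->] := rho_span W; rewrite !mulmx_sumr Gsum.
  by apply: eq_bigr => p _; rewrite -!scalemxAr GZ Gr.
have [c G1] : exists c, G 1%:M = c%:M.
  by apply: comm_mx_all_scalar => B; rewrite -Gl' -Gr' mulmx1 mul1mx.
have GE P : G P = c *: P by rewrite -[P in LHS]mulmx1 Gl' G1 mul_mx_scalar.
rewrite -/(G Phi) GE scalerA.
(* The entries of [G] determine [sum_j U_j Y V_j]; take [Y = rho z]. *)
have C (Y : 'M[F]_r) : \sum_j rho (u j) *m Y *m rho (v j) = (c * \tr Y)%:M.
  apply/matrixP=> a l; rewrite summxE.
  transitivity (\sum_p \sum_q Y p q * G (delta_mx l q) a p).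
    under eq_bigr do rewrite mxE.
    under eq_bigr do (under eq_bigr do rewrite mxE mulr_suml).
    rewrite exchange_big /=; under eq_bigr do rewrite exchange_big /=.
    rewrite exchange_big /=; apply: eq_bigr => p _; apply: eq_bigr => q _.
    rewrite summxE mulr_sumr; apply: eq_bigr => j _; rewrite mxE.
    suff -> : \tr (delta_mx l q *m rho (v j)) = rho (v j) q l.
      by rewrite mulrAC mulrC; congr (_ * _); apply: mulrC.
    rewrite /mxtrace (bigD1 l) //= big1 ?addr0 => [|i nil].
      rewrite mxE (bigD1 q) //= big1 ?addr0 => [|i niq].
        by rewrite mxE !eqxx mul1r.
      by rewrite mxE (negPf niq) andbF mul0r.
    by rewrite mxE big1 // => k _; rewrite mxE (negPf nil) mul0r.
  under eq_bigr do (under eq_bigr do rewrite GE mxE mxE).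
  rewrite mxE mulr_sumr.
  case: (a == l) => /=; last first.
    rewrite mulr0n big1 // => p _; rewrite big1 // => q _.
    by rewrite mulr0 mulr0.
  rewrite mulr1n; apply: eq_bigr => p _; rewrite (bigD1 p) //= eqxx big1.
    by rewrite addr0 mulr1 mulrC.
  by move=> q nqp; rewrite eq_sym (negPf nqp) !mulr0.
have := C (rho z).
have -> : \sum_j rho (u j) *m rho z *m rho (v j) = 1%:M.
  rewrite -[1%:M]/(1 : 'M_r) -(rmorph1 rho) -casz rmorph_sum.
  by apply: eq_bigr => j _; rewrite !rmorphM.
move/(congr1 (fun M => M *m Phi)).
by rewrite mul1mx mul_scalar_mx mulrC => <-.
Qed.

End CasimirMatrix.

(** * Decomposition of a representation under the embeddings of L *)

Section Multiplicity.

Variables (gT : finGroupType) (K : fieldType) (L : fieldExtType K).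
Variables (to : field_action gT L) (n : nat).
Hypothesis n_def : n = #|action_kernel to|.
Hypothesis n_unit : (n%:R : K) \is a GRing.unit.
Variables (h : nat) (y ystar : 'I_h -> L).
Hypothesis y_span : forall w, exists c : 'I_h -> K, w = \sum_l c l *: y l.
Hypothesis dual : forall l m, alg_trace (y l * ystar m) = (l == m)%:R.
Hypothesis h_gt0 : (0 < h)%N.

Variables (F : fieldType) (r : nat) (iL : {rmorphism L -> F}).
Variable rho : {rmorphism twisted_ring to -> 'M[F]_r}.
Hypothesis rhoA : forall c : K, rho c%:A = (iL c%:A)%:M.

Local Notation N := (action_kernel to).
Local Notation T := (kernel_transversal to).
Local Notation Tr := (@alg_trace K L).
Local Notation rL w := (rho (tw to 1%g w)).
Let rhoZ := rhoZ rhoA.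

(** The projection onto the part where L acts through the embedding w |-> iL(w^s), as [eigen_idemP]
    and [eigen_idemM] confirm. *)
Definition eigen_idem s : 'M[F]_r := \sum_l iL (to (y l) s) *: rL (ystar l).
Local Notation e := eigen_idem.

Lemma rLM w w' : rL (w * w') = rL w *m rL w'.
Proof. by rewrite -[RHS]rmorphM tw_mulE mulg1 faction_id. Qed.

Lemma rL_sum (G : 'I_h -> L) : rL (\sum_l G l) = \sum_l rL (G l).
Proof. by rewrite (morphD_sum _ (twD to 1%g)) rmorph_sum. Qed.

Lemma rL_Z c w : rL (c *: w) = iL c%:A *: rL w.
Proof. by rewrite twZ rhoZ. Qed.

Lemma eigen_idemP w s : rL w *m e s = iL (to w s) *: e s.
Proof.
rewrite /eigen_idem mulmx_sumr.
under eq_bigr => l _ do rewrite -scalemxAr -rLM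
  [w * _](dual_expandV y_span dual h_gt0) rL_sum scaler_sumr.
rewrite exchange_big scaler_sumr; apply: eq_bigr => m _ /=.
rewrite scalerA -rmorphM -factionM [w * y m](dual_expand y_span dual).
rewrite faction_sum rmorph_sum scaler_suml; apply: eq_bigr => l _.
rewrite rL_Z scalerA -rmorphM factionZ; congr (iL _ *: _).
by rewrite mulr_algr mulrA [y m * w]mulrC.
Qed.

Lemma eigen_idemM s t :
  e s *m e t = if (s * t^-1)%g \in N then e t else 0.
Proof.
rewrite {1}/eigen_idem mulmx_suml.
under eq_bigr => l _ do rewrite -scalemxAl eigen_idemP scalerA -rmorphM.
rewrite -scaler_suml -rmorph_sum (sum_dual_faction2 to y_span dual h_gt0).
by case: (_ \in _); rewrite ?rmorph1 ?rmorph0 ?scale1r ?scale0r.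
Qed.

(** Group elements permute the idempotents by conjugation, which is why they all have the same
    rank. *)
Lemma eigen_idem_conj s t :
  e t *m rho (tw to s 1) = rho (tw to s 1) *m e (s^-1 * t)%g.
Proof.
rewrite /eigen_idem mulmx_suml.
under eq_bigr => l _ do rewrite -scalemxAl -[_ *m _]rmorphM tw_conj tw_split
  rmorphM [to (ystar l) s](dual_expandV y_span dual h_gt0) rL_sum.
rewrite mulmx_sumr.
under eq_bigr => l _ do rewrite -[_ * _]/(_ *m _) mulmx_sumr scaler_sumr.
rewrite exchange_big; apply: eq_bigr => m _ /=.
rewrite -scalemxAr faction_mulg {1}[to (y m) _](dual_expand y_span dual).
rewrite faction_sum rmorph_sum scaler_suml; apply: eq_bigr => l _.
rewrite rL_Z -scalemxAr scalerA -rmorphM factionZ mulr_algr; congr (iL (_ *: _) *: _).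
rewrite -(trace_faction to y_span dual h_gt0 s (to (y m) _ * _)).
by rewrite factionM factionKV.
Qed.

Lemma rank_eigen_idem s : \rank (e s) = \rank (e 1%g).
Proof.
have sU : rho (tw to s 1) \in unitmx.
  have /mulmx1_unit[] // : rho (tw to s 1) *m rho (tw to s^-1%g 1) = 1%:M.
  by rewrite -[_ *m _]rmorphM tw_mulE mulgV faction1 mulr1 tw1 rmorph1.
have := eigen_idem_conj s s; rewrite mulVg => /(congr1 mxrank).
by rewrite mxrankMfree ?row_free_unit // => ->; rewrite eqmxMfull ?row_full_unit.
Qed.

Lemma n_neq0 : (n%:R : F) != 0.
Proof.
rewrite -(rmorph_nat (iL \o in_alg L)) fmorph_eq0 -unitfE.
exact: n_unit.
Qed.

(** Summed over all of G, the coefficients become n Tr(y_l), and the Tr(y_l) y*_l add up to 1; then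
    n is cancelled. *)
Lemma sum_eigen_idem : \sum_(s in T) e s = 1%:M.
Proof.
have eN t s : t \in N -> e (t * s)%g = e s.
  move=> /action_kernelP tN; apply: eq_bigr => l _.
  by rewrite faction_mulg tN.
have := sum_kernel_transversal n_def eN.
have -> : \sum_s e s = n%:R *: 1%:M.
  rewrite exchange_big /=; under eq_bigr => l _ do
    rewrite -scaler_suml -rmorph_sum (sum_faction n_def y_span dual h_gt0)
            -rL_Z -[y l]mulr1 -scalerA.
  rewrite -rL_sum -scaler_sumr -(dual_expandV y_span dual h_gt0) rL_Z tw1 rmorph1.
  by congr (_ *: _); apply: (rmorph_nat (iL \o in_alg L)).
by rewrite -scaler_nat => /(scalerI n_neq0).
Qed.

Lemma sum_rank_eigen_idem : (h * \rank (e 1%g))%N = r.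
Proof.
rewrite -(card_kernel_transversal n_def n_unit y_span dual h_gt0) -sum_nat_const.
rewrite -[RHS](sum_rank_idem _ sum_eigen_idem).
  by apply: eq_bigr => s _; rewrite rank_eigen_idem.
by move=> s t sT tT; rewrite eigen_idemM kernel_transversal_inj //; case: eqP => [->|].
Qed.

(** On the image of e_s, w acts as w^s, and all ranks equal r / h; so the trace is r / h times the
    sum of the w^s over T, which is Tr w = 1. *)
Lemma trace_eigen w : Tr w = 1 -> \tr (rL w) = (r %/ h)%:R.
Proof.
move=> Tw; have -> : (r %/ h)%N = \rank (e 1%g).
  by rewrite -[X in (X %/ h)%N]sum_rank_eigen_idem mulKn.
rewrite -[rL w]mulmx1 -sum_eigen_idem mulmx_sumr raddf_sum /=.
have trE s : \tr (rL w *m e s) = iL (to w s) * (\rank (e 1%g))%:R.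
  rewrite eigen_idemP mxtraceZ mxtrace_idem ?rank_eigen_idem //.
  by rewrite eigen_idemM mulgV; case: action_kernelP => // -[]; apply: faction_id.
under eq_bigr do rewrite trE.
rewrite -mulr_suml -rmorph_sum.
suff -> : \sum_(s in T) to w s = 1 by rewrite rmorph1 mul1r.
have nL : (n%:R : L) != 0 by rewrite -(fmorph_eq0 iL) rmorph_nat n_neq0.
apply: (mulfI nL); rewrite mulr_natl -sum_kernel_transversal //; last first.
  by move=> t s /action_kernelP tN; rewrite faction_mulg tN.
rewrite (sum_faction n_def y_span dual h_gt0) Tw !mulr1.
exact: (rmorph_nat (in_alg L)).
Qed.

End Multiplicity.

(** * Endomorphisms of a simple module as matrices *)

Section EndMatrix.

Variables (K : fieldType) (A : falgType K) (X : simple_rmodule A).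
Local Notation D := (modend X).
Local Notation Z := (alg_center D).

Lemma modendM (p q : D) w : vsval (p * q) w = vsval p (vsval q w).
Proof. exact: comp_lfunE. Qed.

Lemma modend1 w : vsval (1 : D) w = w.
Proof.
have /eqP a1 : algid (modend_aspace X) == 1 by rewrite algid_eq1 centv1.
by rewrite -[vsval 1]/(algid (modend_aspace X)) a1 id_lfunE.
Qed.

Lemma modendV (p : D) : p != 0 -> exists q : D, p * q = 1.
Proof.
move=> nzp; pose f : 'End(X) := vsval p.
have fM : rhom f by apply/modendP/subvsP.
have nzf : f != 0 by apply: contra nzp => /eqP f0; apply/eqP/val_inj.
have [g fK gK] := simple_rhom_bij fM nzf.
have ker0 : lker f == 0%VS by apply/lker0P/(can_inj fK).
have gM : (f^-1%VF : lin_end X) \in modend_aspace X.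
  apply/modendP=> w a; apply: (can_inj fK).
  by rewrite lker0_lfunVK // fM lker0_lfunVK.
exists (Subvs gM); apply: val_inj; apply/lfunP=> w.
by rewrite modendM modend1 /= lker0_lfunVK.
Qed.

Variables (x : nat) (b : left_basis X x).
Local Notation v := (lb_vec b).
Local Notation crd := (lb_coord b).
Local Notation emx := (end_mx b).

Lemma lb_coord_uniq w (s : 'rV[D]_x) :
  w = \sum_j vsval (s 0 j) (v j) -> crd w = s.
Proof. by move->; apply: lb_combK. Qed.

Lemma lb_coordD : {morph crd : w w' / w + w'}.
Proof.
move=> w w'; apply: lb_coord_uniq.
rewrite -{1}(lb_coordK b w) -{1}(lb_coordK b w') -big_split.
by apply: eq_bigr => j _; rewrite mxE add_lfunE.
Qed.

Lemma lb_coordM (p : D) w j : crd (vsval p w) 0 j = p * crd w 0 j.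
Proof.
rewrite (@lb_coord_uniq _ (\row_j (p * crd w 0 j))) ?mxE //.
rewrite -{1}(lb_coordK b w) linear_sum; apply: eq_bigr => i _.
by rewrite mxE modendM.
Qed.

Lemma modendZ1 c w : vsval (c *: 1 : D) w = c *: w.
Proof. by rewrite scale_lfunE modend1. Qed.

Lemma lb_coordZ c w j : crd (c *: w) 0 j = c *: crd w 0 j.
Proof. by rewrite -modendZ1 lb_coordM -scalerAl mul1r. Qed.

Lemma end_mxD : {morph emx : f g / f + g}.
Proof.
by move=> f g; apply/matrixP=> i j; rewrite !mxE add_lfunE lb_coordD mxE.
Qed.

(** The factors change order because X consists of rows, on which matrices act from the right. *)
Lemma end_mxM (f g : lin_end X) :
  g \in biend X -> emx (g \o f)%VF = emx f *m emx g.
Proof.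
move/biendP=> gC; apply/matrixP=> i k; rewrite !mxE comp_lfunE.
rewrite -{1}(lb_coordK b (f (v i))) linear_sum (morphD_sum _ lb_coordD) summxE.
by apply: eq_bigr => j _; rewrite /= gC lb_coordM !mxE.
Qed.

Lemma lb_coord_vec i : crd (v i) = \row_j (i == j)%:R.
Proof.
apply: lb_coord_uniq; rewrite (bigD1 i) //= mxE eqxx modend1 big1 ?addr0 //.
by move=> j nji; rewrite mxE eq_sym (negPf nji) zero_lfunE.
Qed.

Lemma end_mx_inj (f g : lin_end X) :
  f \in biend X -> g \in biend X -> emx f = emx g -> f = g.
Proof.
move=> /biendP fC /biendP gC /matrixP e; apply/lfunP=> w.
rewrite -(lb_coordK b w) !linear_sum; apply: eq_bigr => i _ /=.
rewrite fC gC; congr (fun_of_lfun (vsval _) _).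
rewrite -(lb_coordK b (f (v i))) -[RHS](lb_coordK b); apply: eq_bigr => j _.
by have := e i j; rewrite !mxE => ->.
Qed.

Lemma end_mx_surj (M : 'M[D]_x) :
  exists2 f : lin_end X, f \in biend X & emx f = M.
Proof.
pose f w := \sum_i vsval (crd w 0 i) (\sum_j vsval (M i j) (v j)).
have modendD (p q : D) w : vsval (p + q) w = vsval p w + vsval q w.
  by rewrite add_lfunE.
have fD : {morph f : w w' / w + w'}.
  move=> w w'; rewrite /f -big_split; apply: eq_bigr => i _ /=.
  by rewrite lb_coordD mxE modendD.
have fC (p : D) w : f (vsval p w) = vsval p (f w).
  by rewrite linear_sum; apply: eq_bigr => i _; rewrite lb_coordM modendM.
have fL : linear f.
  move=> c w w'; rewrite fD; congr (_ + _).
  by rewrite -!modendZ1 fC.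
exists (hom_of fL : lin_end X); first by apply/biendP=> p w; rewrite !hom_ofE fC.
apply/matrixP=> i k; rewrite mxE hom_ofE.
rewrite (@lb_coord_uniq _ (\row_j M i j)) ?mxE //.
rewrite /f lb_coord_vec (bigD1 i) //= [X in _ + X]big1 ?addr0 => [|j nji].
  by rewrite mxE eqxx modend1; apply: eq_bigr => j _; rewrite mxE.
by rewrite mxE eq_sym (negPf nji) zero_lfunE.
Qed.

(** Through [density], it follows that the center of K_i acts on X as elements of A do. *)
Lemma center_biend (t : subvs_of Z) : vsval (vsval t) \in biend X.
Proof.
apply/biendP=> p w; rewrite -!modendM; congr (fun_of_lfun (vsval _) w).
by have /memv_capP[_ /centvP tC] := subvsP t; rewrite tC ?memvf.
Qed.

Lemma end_mx_center (t : subvs_of Z) : emx (vsval (vsval t)) = (vsval t)%:M.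
Proof.
by apply/matrixP=> i j; rewrite !mxE lb_coordM lb_coord_vec mxE mulr_natr.
Qed.

(** * The matrix representation of A over a splitting field *)

Section Representation.

Variables (d : nat) (F : fieldType) (iZ : {rmorphism subvs_of Z -> F}).
Variable rep : {rmorphism D -> 'M[F]_d}.
Hypothesis repZ : forall t, rep (vsval t) = (iZ t)%:M.
Hypothesis rep_span : forall M, exists s : seq (F * D),
  M = \sum_(p <- s) p.1 *: rep p.2.
Hypothesis d_gt0 : (0 < d)%N.

Definition blockrep (M : 'M[D]_x) := \mxblock_(i < x, j < x) rep (M i j).

Local Notation R f := (blockrep (emx f)).

Lemma blockrepD : {morph blockrep : M M' / M + M'}.
Proof.
move=> M M'; rewrite -mxblockD; apply: eq_mxblock => i j.
by rewrite mxE rmorphD.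
Qed.

Lemma blockrepM M M' : blockrep (M *m M') = blockrep M *m blockrep M'.
Proof.
rewrite mul_mxblock; apply: eq_mxblock => i k.
by rewrite mxE rmorph_sum; apply: eq_bigr => j _; rewrite rmorphM.
Qed.

Lemma blockrep_scalar (t : subvs_of Z) : blockrep (vsval t)%:M = (iZ t)%:M.
Proof.
rewrite -mxdiagZ; apply: eq_mxblock => i j; rewrite mxE.
by case: eqP => _; rewrite ?mulr1n ?mulr0n ?rmorph0 ?conform_mx_id ?repZ.
Qed.

Lemma blockrep1 : blockrep 1%:M = 1%:M.
Proof.
have /eqP a1 : algid Z == 1 by rewrite algid_eq1 memv_cap memvf centv1.
by rewrite -{1}a1 (blockrep_scalar 1) rmorph1.
Qed.

(** D is a skew field, and d > 0 keeps the target from being the zero ring. *)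
Lemma rep_inj : injective rep.
Proof.
move=> p q e; apply/eqP; rewrite -subr_eq0; apply: contraT => /modendV[k pk].
have := rmorph1 rep; rewrite -pk rmorphM rmorphB e subrr mul0r.
case: (d) d_gt0 => // d' _ /matrixP/(_ 0 0)/eqP.
by rewrite !mxE eqxx eq_sym oner_eq0.
Qed.

Lemma blockrep_inj : injective blockrep.
Proof.
move=> M M' e; apply/matrixP=> i j; apply: rep_inj.
by have := congr1 (fun B => submxblock B i j) e; rewrite !mxblockK.
Qed.

Lemma blockrep_trace M : \tr (blockrep M) = \tr (rep (\tr M)).
Proof. by rewrite mxtrace_mxblock rmorph_sum raddf_sum. Qed.

Lemma blockrep_span B : exists s : seq (F * 'M[D]_x),
  B = \sum_(p <- s) p.1 *: blockrep p.2.
Proof.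
pose E i j (Y : 'M[F]_d) :=
  \mxblock_(i' < x, j' < x) if (i' == i) && (j' == j) then Y else 0.
have -> : B = \sum_i \sum_j E i j (submxblock B i j).
  apply/mxblockP=> i j; rewrite submxblock_sum.
  rewrite (eq_bigr (fun k => \sum_l submxblock (E k l (submxblock B k l)) i j));
    last by move=> k _; rewrite submxblock_sum.
  rewrite (bigD1 i) //= (bigD1 j) //= mxblockK !eqxx !big1 ?addr0 //.
  - by move=> k nki; rewrite big1 // => l _; rewrite mxblockK eq_sym (negPf nki).
  by move=> k nkj; rewrite mxblockK [j == k]eq_sym (negPf nkj) andbF.
apply: span_sum => i _; apply: span_sum => j _.
have [s ->] := rep_span (submxblock B i j).
pose e (k : D) : 'M[D]_x :=
  \matrix_(i', j') if (i' == i) && (j' == j) then k else 0.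
exists [seq (p.1, e p.2) | p <- s]; rewrite big_map.
apply/matrixP=> p q; rewrite mxE summxE.
under [RHS]eq_bigr do rewrite mxE mxE mxE.
case: (_ && _); first by rewrite summxE; apply: eq_bigr => k _; rewrite mxE.
by rewrite mxE big1 // => k _; rewrite rmorph0 mxE mulr0.
Qed.

Lemma center_char_inj : injective iZ.
Proof. by move=> s t e; apply/val_inj/rep_inj; rewrite /= !repZ e. Qed.

Lemma center_char_scale c s : iZ (c *: s) = iZ c%:A * iZ s.
Proof. by rewrite -rmorphM mulr_algl. Qed.

Section ReducedTrace.

Variable trd : D -> subvs_of Z.
Hypothesis trdE : forall p, iZ (trd p) = \tr (rep p).

(** [trd] is known only through its image in F; linearity is pulled back along the injective
    [iZ]. *)
Lemma reduced_trace_linear : linear trd.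
Proof.
have repA c : rep c%:A = (iZ c%:A)%:M.
  rewrite -repZ; congr (rep _); apply/val_inj.
  have /eqP a1 : algid Z == 1 by rewrite algid_eq1 memv_cap memvf centv1.
  by rewrite linearZ /= a1.
move=> c p q; apply: center_char_inj; rewrite rmorphD center_char_scale !trdE.
rewrite rmorphD -[c *: p]mulr_algl rmorphM repA mxtraceD; congr (_ + _).
by rewrite -mxtraceZ -mul_scalar_mx.
Qed.

Lemma trace_functional_linear (phi : lin_end X) :
  linear (fun f : lin_end X =>
    alg_trace (trd (\tr (emx (phi \o f)%VF))) : K^o).
Proof.
move=> c f g; rewrite -alg_trace_linear -reduced_trace_linear.
congr (alg_trace (trd _)); rewrite /mxtrace scaler_sumr -big_split.
apply: eq_bigr => i _; rewrite /= !mxE !comp_lfunE add_lfunE scale_lfunE linearP.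
by rewrite lb_coordD mxE lb_coordZ.
Qed.

End ReducedTrace.

Definition end_rep_fun a := R (ract_end X a).

Fact end_rep_zmod_morphism : zmod_morphism end_rep_fun.
Proof.
have D a c : end_rep_fun (a + c) = end_rep_fun a + end_rep_fun c.
  by rewrite /end_rep_fun linearD end_mxD blockrepD.
by move=> a c; apply: (addIr (end_rep_fun c)); rewrite -D !subrK.
Qed.

Fact end_rep_monoid_morphism : monoid_morphism end_rep_fun.
Proof.
split=> [|a c]; last first.
  by rewrite /end_rep_fun ract_endM end_mxM ?ract_end_biend // blockrepM.
rewrite /end_rep_fun (_ : ract_end X 1 = \1%VF).
  rewrite -[RHS]blockrep1; congr blockrep; apply/matrixP=> i j.
  by rewrite !mxE id_lfunE lb_coord_vec mxE.
by apply/lfunP=> w; rewrite ract_endE ract1 id_lfunE.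
Qed.

Definition end_rep : {rmorphism A -> 'M[F]_(\sum_(i < x) d)} :=
  HB.pack end_rep_fun (GRing.isZmodMorphism.Build _ _ _ end_rep_zmod_morphism)
    (GRing.isMonoidMorphism.Build _ _ _ end_rep_monoid_morphism).

Lemma end_repE a : end_rep a = R (ract_end X a).
Proof. by []. Qed.

Lemma end_repA c : end_rep c%:A = (iZ c%:A)%:M.
Proof.
rewrite end_repE -blockrep_scalar -end_mx_center; congr (blockrep (emx _)).
apply/lfunP=> w; rewrite ract_endE ractZr ract1.
have -> : vsval (vsval (c%:A : subvs_of Z)) =
  c *: vsval (vsval (1 : subvs_of Z)) by [].
have /eqP a1 : algid Z == 1 by rewrite algid_eq1 memv_cap memvf centv1.
by rewrite scale_lfunE -[vsval (1 : subvs_of Z)]/(algid Z) a1 modend1.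
Qed.

Section Inversion.

Variables (lam : A -> K) (J : finType) (u u' : J -> A) (z : A).
Hypothesis lamC : forall a c, lam (a * c) = lam (c * a).
Hypothesis expu : forall a, a = \sum_j lam (u' j * a) *: u j.
Hypothesis expu' : forall a, a = \sum_j lam (a * u j) *: u' j.
Hypothesis casz : \sum_j u j * z * u' j = 1.
Variable trd : D -> subvs_of Z.
Hypothesis trdE : forall p, iZ (trd p) = \tr (rep p).
Variable m : nat.
Hypothesis mE : \tr (end_rep z) = m%:R.

Lemma end_rep_span B : exists s : seq (F * A),
  B = \sum_(p <- s) p.1 *: end_rep p.2.
Proof.
have [s ->] := blockrep_span B; apply: span_sum => p _.
have [f fB fE] := end_mx_surj p.2.
have [a fa] := density expu expu' casz fB.
by exists [:: (p.1, a)]; rewrite big_seq1 end_repE -fa fE.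
Qed.

(** With t(a) the Z-valued trace of phi times a, replacing Tr_{Z/K}(t(v)) by t(v) itself gives the
    sum of t(v) u. In matrices over F, t(v) becomes the scalar tr(rho(v) Phi), and
    [mx_casimir_scalar] applies. *)
Lemma inversion_diag (phi : lin_end X) : phi \in biend X ->
  m%:R *: (\sum_j alg_trace (trd (\tr (emx (phi \o ract_end X (u' j))%VF)))
     *: ract_end X (u j)) = phi.
Proof.
move=> phiB.
pose t a := trd (\tr (emx (phi \o ract_end X a)%VF)).
have tE a : iZ (t a) = \tr (end_rep a *m R phi).
  by rewrite trdE -blockrep_trace end_mxM // blockrepM.
have tD : {morph t : a c / a + c}.
  move=> a c; apply: center_char_inj.
  by rewrite rmorphD !tE rmorphD mulmxDl mxtraceD.
have tZ c a : t (c *: a) = c *: t a.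
  apply: center_char_inj; rewrite center_char_scale !tE (rhoZ end_repA).
  by rewrite -scalemxAl mxtraceZ.
have center_act (s : subvs_of Z) : exists a, vsval (vsval s) = ract_end X a.
  by have [a ea] := density expu expu' casz (center_biend s); exists a.
have tM a c s : vsval (vsval s) = ract_end X a -> t (c * a) = t c * s.
  move=> sa; apply: center_char_inj; rewrite rmorphM !tE rmorphM.
  rewrite -[_ * end_rep a]/(_ *m _) [end_rep a]end_repE -sa end_mx_center.
  by rewrite blockrep_scalar mul_mx_scalar -scalemxAl mxtraceZ mulrC.
pose e := vbasis {:subvs_of Z}.
(* Moving a K-basis of the center across the Casimir element turns the trace
   from the center down to K into multiplication by [t]. *)
have -> : \sum_j alg_trace (t (u' j)) *: ract_end X (u j) =
    \sum_j (ract_end X (u j) \o vsval (vsval (t (u' j))))%VF.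
  under eq_bigr => j _ do rewrite alg_trace_coord scaler_suml.
  rewrite exchange_big /=.
  transitivity (\sum_i \sum_j coord e i (t (u' j)) *:
      (ract_end X (u j) \o vsval (vsval e`_i))%VF).
    apply: eq_bigr => i _; have [a ea] := center_act e`_i.
    under eq_bigr do rewrite -(tM a) //.
    under [RHS]eq_bigr do rewrite ea -ract_endM.
    rewrite (casimirL expu expu'
      (Psi := fun p q => coord e i (t q) *: ract_end X p)) //.
    - by move=> c p q; rewrite linearD scalerDr.
    - by move=> c p q; rewrite tD linearD scalerDl.
    by move=> c p q; rewrite tZ !linearZ /= scalerA mulrC.
  rewrite exchange_big; apply: eq_bigr => j _ /=.
  apply/lfunP=> w; rewrite sum_lfunE comp_lfunE.
  rewrite [X in vsval (vsval X)](coord_vbasis (memvf (t (u' j)))) !linear_sum.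
  rewrite sum_lfunE linear_sum; apply: eq_bigr => i _.
  by rewrite /= !scale_lfunE comp_lfunE linearZ.
set G := \sum_j _.
have GB : m%:R *: G \in biend X.
  apply/memvZ/memv_suml => j _; apply/biendP=> p w.
  rewrite !comp_lfunE.
  have /biendP-> := center_biend (t (u' j)).
  by have /biendP-> := ract_end_biend X (u j).
apply: end_mx_inj => //; apply: blockrep_inj.
pose Rf f := R f.
have RD : {morph Rf : f g / f + g} by move=> f g; rewrite /Rf end_mxD blockrepD.
rewrite scaler_nat -/(Rf _).
rewrite -(mx_casimir_scalar lamC expu expu' casz end_repA end_rep_span (R phi)).
rewrite mE scaler_nat.
(* [blockrep] is available as an additive map only, so the scalar m crosses it as an m-fold sum. *)
have -> : Rf (G *+ m) = Rf G *+ m.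
  elim: (m) => [|m' IH]; last by rewrite !mulrS RD IH.
  by apply: (addrI (Rf (G *+ 0))); rewrite -RD !mulr0n !addr0.
congr (_ *+ m); rewrite /G (morphD_sum _ RD); apply: eq_bigr => j _.
rewrite /Rf end_mxM ?ract_end_biend // blockrepM end_mx_center blockrep_scalar.
by rewrite tE mul_scalar_mx mxtrace_mulC.
Qed.

End Inversion.

End Representation.
End EndMatrix.

(** * Fourier inversion *)

Theorem corollary1p18
    (gT : finGroupType) (K : fieldType) (L : fieldExtType K)
    (to : field_action gT L)
    (n : nat) (n_def : n = #|action_kernel to|)
    (n_unit : (n%:R : K) \is a GRing.unit)
    (h : nat) (h_def : h = \dim {:L})
    (y ystar : h.-tuple L) (y_basis : basis_of {:L} y)
    (ystar_dual : forall l m : 'I_h,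
       alg_trace (tnth y l * tnth ystar m) = (l == m)%:R)
    (k : nat) (X : 'I_k -> simple_rmodule (twisted_ring to))
    (X_exhaustive : forall S : simple_rmodule (twisted_ring to),
       exists i, rmod_iso S (X i))
    (X_irredundant : forall i j, rmod_iso (X i) (X j) -> i = j)
    (x : 'I_k -> nat) (b : forall i, left_basis (X i) (x i))
    (d : 'I_k -> nat) (d_ge1 : forall i, (1 <= d i)%N)
    (d_def : forall i,
       (d i ^ 2)%N = \dim_(alg_center (modend (X i))) {:modend (X i)})
    (trd : forall i, modend (X i) -> subvs_of (alg_center (modend (X i))))
    (trd_def : forall i, is_reduced_trace (d i) (trd i)) :
  let omega_inv (phi : forall i, subvs_of (biend (X i))) : twisted_ring to :=
    (n%:R : K)^-1 *: \sum_(s : gT) \sum_(l < h)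
      (\sum_(i < k) ((x i * d i) %/ h)%:R *
         alg_trace (trd i (\tr (end_mx (b i)
           (vsval (phi i) \o
            vsval (omega (X i) (tw to 1%g (tnth ystar l) * tw to s^-1%g 1)))%VF))))
      *: tw to s (tnth y l) in
  (forall a : twisted_ring to, omega_inv (fun i => omega (X i) a) = a) /\
  (forall (phi : forall i, subvs_of (biend (X i))) (i : 'I_k),
     omega (X i) (omega_inv phi) = phi i).
Proof.
move=> omega_inv.
have h_gt0 : (0 < h)%N by rewrite h_def adim_gt0.
pose y' := tnth y; pose ys := tnth ystar.
have y_span w : exists c : 'I_h -> K, w = \sum_l c l *: y' l.
  exists (fun l => coord y l w); rewrite {1}(coord_basis y_basis (memvf w)).
  by apply: eq_bigr => l _; rewrite /y' (tnth_nth 0).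
have dual : forall l m, alg_trace (y' l * ys m) = (l == m)%:R := ystar_dual.
pose u := tw_basis to n y'; pose u' := tw_dual to ys.
pose lam : twisted_ring to -> K := tw_form n.
have lamC : forall a c, lam (a * c) = lam (c * a).
  exact: tw_formC y_span dual h_gt0.
have expu : forall a, a = \sum_j lam (u' j * a) *: u j.
  by move=> a; apply: (tw_expand (to := to) n_unit y_span dual).
have expu' : forall a, a = \sum_j lam (a * u j) *: u' j.
  by move=> a; apply: (tw_expandV (to := to) n_unit y_span dual h_gt0).
have casz := tw_casimir (to := to) n_def n_unit y_span dual h_gt0.
pose psi i (phi f : lin_end (X i)) : K^o :=
  alg_trace (trd i (\tr (end_mx (b i) (phi \o f)%VF))).
have omega_invE phi : omega_inv phi =
    \sum_i ((x i * d i) %/ h)%:R *: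
      \sum_j psi i (vsval (phi i)) (ract_end (X i) (u' j)) *: u j.
  rewrite /omega_inv pair_bigA scaler_sumr.
  under [RHS]eq_bigr do rewrite scaler_sumr.
  rewrite [RHS]exchange_big; apply: eq_bigr => j _ /=.
  rewrite scaler_suml scaler_sumr; apply: eq_bigr => i _.
  by rewrite !scalerA mulrC.
have inv phi i : omega (X i) (omega_inv phi) = phi i.
  apply/eqP; have sepL := faction_separable to.
  (* The goal has been made a boolean equality, which allows [classically] to be eliminated. *)
  apply: (ex_splitting_over sepL (trd_def i)) =>
    -[F [iZ [rep [iL [repZ rep_span trdE iZL]]]]].
  apply/eqP/val_inj; rewrite -[val _]/(ract_end (X i) (omega_inv phi)).
  pose rho := end_rep (b i) repZ.
  have rhoA c : rho c%:A = (iL c%:A)%:M by rewrite /rho end_repA iZL.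
  (* The representation has size the sum of x_i copies of d_i, so its multiplicity r / h is the
     coefficient in the formula. *)
  have rho_z : \tr (rho (tw to 1%g (unit_trace_elt y' ys h_gt0))) =
      ((x i * d i) %/ h)%:R.
    rewrite (trace_eigen n_def n_unit y_span dual h_gt0 rhoA).
      by rewrite sum_nat_const card_ord.
    exact: unit_trace_eltP.
  have diag := inversion_diag rep_span (d_ge1 i) lamC expu expu' casz trdE
    rho_z (subvsP (phi i)).
  rewrite -[RHS]diag omega_invE linear_sum (bigD1 i) //= [X in _ + X]big1 ?addr0.
    rewrite linearZ linear_sum; congr (_ *: _); apply: eq_bigr => j _.
    by rewrite linearZ.
  move=> i' ni'; apply/eqP.
  (* A splitting for i' is chosen as well, to obtain the linearity of its trace functional. *)
  apply: (ex_splitting_over sepL (trd_def i')) =>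
    -[F' [iZ' [rep' [_ [repZ' _ trdE' _]]]]].
  have psiL :=
    trace_functional_linear (b i') repZ' (d_ge1 i') trdE' (vsval (phi i')).
  pose psi' : {linear lin_end (X i') -> K^o} :=
    HB.pack (psi i' (vsval (phi i'))) (GRing.isLinear.Build _ _ _ _ _ psiL).
  apply/eqP; rewrite linearZ linear_sum.
  under eq_bigr do rewrite linearZ.
  rewrite (schur_orthogonality expu expu' psi') /= ?scaler0 //.
  by move/X_irredundant=> e; rewrite e eqxx in ni'.
split=> // a; set a' := omega_inv _.
(* By [inv], a' and a act alike on each X_i, hence on every simple module, so a' - a is
   annihilated. *)
have act_a' i (w : X i) : ract w a' = ract w a by rewrite -!omegaE inv.
clearbody a'; apply/eqP; rewrite -subr_eq0; apply/eqP.
apply: (annihilator0 expu expu' casz) => S s.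
have [i [f [g fK _] fM]] := X_exhaustive S.
apply: (can_inj fK); rewrite fM linear0 -[RHS](ract0r (f s)).
by rewrite -scaleN1r ractDr ractZr act_a' scaleN1r subrr ract0r.
Qed.
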